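(* Let $\mathcal F=\{f_i(x)=r_ix+b_i\}_{i=1}^m$ be an affine reverse iterated function system on $\mathbb R$, with $r_i,b_i\in\mathbb R$ and $|r_i|>1$ for all $i$. Then the limit $$d_{\mathcal F}=\lim_{R\to\infty}\frac{\log \#\{g\in G^*(\mathcal F):|g'|\le R\}}{\log R}$$ exists, the box-counting dimension $\dim_{\mathrm B}K(\mathcal F^{-1})$ exists, and $$\dim_{\mathrm B}K(\mathcal F^{-1})\le d_{\mathcal F}\le s .$$ Moreover, for every $a\in\mathbb R$, $$\dim_{\mathrm M}\mathcal O^+_{\mathcal F}(a)=\begin{cases} d_{\mathcal F}, & \text{if }\mathcal O^+_{\mathcal F}(a)\text{ is locally finite},\\ \infty,&\text{otherwise},\end{cases}$$ and $$\dim_{\mathrm{Be}}\mathcal O^+_{\mathcal F}(a)=\begin{cases} d_{\mathcal F}\le 1, & \text{if }\mathcal O^+_{\mathcal F}(a)\text{ is uniformly locally finite},\\ \infty,&\text{otherwise}.\end{cases}$$ (In the first case of the last formula, the inequality $d_{\mathcal F}\le 1$ is part of the assertion.)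
   Context: The maps $f_1,\dots,f_m$ are distinct. For a finite nonempty word $\mathbf i=i_1\cdots i_n$ over $\{1,\dots,m\}$ put $f_{\mathbf i}=f_{i_1}\circ\cdots\circ f_{i_n}$. $G^*(\mathcal F)=\{f_{\mathbf i}\}$ is the semigroup of distinct maps generated by $\mathcal F$ (words giving the same map are counted once), and $|g'|$ is the absolute value of the linear coefficient of the affine map $g$. The forward orbit of $a$ is $\mathcal O^+_{\mathcal F}(a)=\{g(a):g\in G^*(\mathcal F)\}$. The dual system is $\mathcal F^{-1}=\{f_i^{-1}\}_{i=1}^m$, a contractive iterated function system on $\mathbb R$; $K(\mathcal F^{-1})$ is its attractor (the unique nonempty compact set $K$ with $K=\bigcup_i f_i^{-1}(K)$). The similarity dimension $s$ is the unique solution of $\sum_{i=1}^m|r_i|^{-s}=1$. A set $E\subseteq\mathbb R$ is locally finite if its intersection with every bounded set is finite, and uniformly locally finite if $\sup_{x\in\mathbb R}\#(E\cap[x-R,x+R])<\infty$ for every $R>0$. Mass dimension: for $\alpha>0$ let $\mathcal C_\alpha^+(E)$ and $\mathcal C_\alpha^-(E)$ be the $\limsup$ and $\liminf$ as $h\to\infty$ of $\#(E\cap[-h,h])/h^\alpha$. The upper (lower) mass dimension is the critical exponent $\inf\{\alpha\ge 0:\mathcal C^{+}_\alpha(E)<\infty\}$ (resp. with $\mathcal C^-_\alpha$), with $\inf\varnothing=\infty$; equivalently the $\limsup$ (resp. $\liminf$) of $\log\#(E\cap[-h,h])/\log h$. If they coincide the common value is $\dim_{\mathrm M}E$. Beurling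 dimension: $\mathcal D_\alpha^+(E)=\limsup_{h\to\infty}\sup_{x\in\mathbb R}\#(E\cap[x-h,x+h])/h^\alpha$ and $\dim_{\mathrm{Be}}E=\inf\{\alpha>0:\mathcal D^+_\alpha(E)<\infty\}$ with $\inf\varnothing=\infty$; equivalently $\dim_{\mathrm{Be}}E=\limsup_{h\to\infty}\sup_{x\in\mathbb R}\log\#(E\cap[x-h,x+h])/\log h$. *)

(* Defs.v *)
From HB Require Import structures.
From mathcomp Require Import all_boot all_order all_algebra.
From mathcomp Require Import all_classical all_reals all_analysis.

Set Implicit Arguments.
Unset Strict Implicit.
Unset Printing Implicit Defensive.

Import Order.TTheory GRing.Theory Num.Theory.
Import numFieldNormedType.Exports.

Local Open Scope classical_set_scope.
Local Open Scope ring_scope.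

Section AffineSystems.
Context {R : realType} {m : nat}.
Implicit Types (r b : 'I_m -> R) (f : 'I_m -> R -> R).

Definition affine_system r b : 'I_m -> R -> R := fun i x => r i * x + b i.

Definition dual_system r b : 'I_m -> R -> R := fun i y => (y - b i) / r i.

Definition word_map f (w : seq 'I_m) : R -> R :=
  foldr (fun i g => f i \o g) idfun w.

(* A set of functions, so words inducing the same map are identified. *)
Definition generated_semigroup f : set (R -> R) :=
  [set word_map f w | w in [set w : seq 'I_m | w != [::]]].

Definition forward_orbit f (a : R) : set R := [set g a | g in generated_semigroup f].

Definition is_attractor f (K : set R) : Prop :=
  [/\ compact K, K !=set0 & K = \bigcup_(i in [set: 'I_m]) (f i @` K)].

Definition is_similarity_dim r (s : R) : Prop :=
  \sum_(i < m) `|r i| `^ (- s) = 1.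

End AffineSystems.

(* The coefficient of x in g, for g affine. *)
Definition linear_coef {R : realType} (g : R -> R) : R := g 1 - g 0.

(* [counting] is the cardinality, with value +oo on infinite sets. *)
Definition growth_count {R : realType} {m : nat} (f : 'I_m -> R -> R)
    (x : R) : \bar R :=
  @counting _ R [set g | generated_semigroup f g /\ `|linear_coef g| <= x].

Section Dimensions.
Context {R : realType}.
Implicit Types (E K : set R).
Local Open Scope ereal_scope.

(* Least number of sets of diameter at most e needed to cover K. *)
Definition covering_number K (e : R) : \bar R :=
  ereal_inf [set (n%:R)%:E | n in [set n : nat |
    exists U : 'I_n -> set R,
      (forall i x y, U i x -> U i y -> (`|x - y| <= e)%R) /\
      K `<=` \bigcup_(i in [set: 'I_n]) U i]].

(* The box-counting dimension of K exists and equals D. *)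
Definition has_box_dim K (D : \bar R) : Prop :=
  lne (covering_number K e) / (- ln e)%:E @[e --> (0%R : R)^'+] --> D.

Definition locally_finite E : Prop :=
  forall B : set R, bounded_set B -> finite_set (E `&` B).

(* #(E `&` [x - h, x + h]) *)
Definition count_around E (x h : R) : \bar R :=
  @counting _ R (E `&` `[(x - h)%R, (x + h)%R]).

Definition max_count E (h : R) : \bar R :=
  ereal_sup [set count_around E x h | x in [set: R]].

Definition uniformly_locally_finite E : Prop :=
  forall h : R, (0 < h)%R -> max_count E h < +oo.

Definition upper_mass_density E (alpha : R) : \bar R :=
  limf_esup (fun h : R => count_around E 0 h / (h `^ alpha)%:E) (pinfty_nbhs R).

Definition lower_mass_density E (alpha : R) : \bar R :=
  limf_einf (fun h : R => count_around E 0 h / (h `^ alpha)%:E) (pinfty_nbhs R).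

Definition upper_mass_dim E : \bar R :=
  ereal_inf [set alpha%:E | alpha in
    [set alpha : R | (0 <= alpha)%R /\ upper_mass_density E alpha < +oo]].

Definition lower_mass_dim E : \bar R :=
  ereal_inf [set alpha%:E | alpha in
    [set alpha : R | (0 <= alpha)%R /\ lower_mass_density E alpha < +oo]].

(* The mass dimension of E exists and equals D. *)
Definition has_mass_dim E (D : \bar R) : Prop :=
  upper_mass_dim E = D /\ lower_mass_dim E = D.

Definition beurling_density E (alpha : R) : \bar R :=
  limf_esup (fun h : R => max_count E h / (h `^ alpha)%:E) (pinfty_nbhs R).

Definition beurling_dim E : \bar R :=
  ereal_inf [set alpha%:E | alpha in
    [set alpha : R | (0 < alpha)%R /\ beurling_density E alpha < +oo]].

End Dimensions.

(* Main.v *)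
Require Import Defs.
From HB Require Import structures.
From mathcomp Require Import all_boot all_order all_algebra finmap.
From mathcomp Require Import all_classical all_reals all_analysis.
From mathcomp Require Import ring lra zify.

Import Order.TTheory GRing.Theory Num.Theory.
Import numFieldNormedType.Exports.

Local Open Scope classical_set_scope.
Local Open Scope ring_scope.

(** Slopes are compared in absolute value throughout.  Write |g'| for the absolute
value of the slope of g and N(x) for the number of maps f_w, the identity
included, with |f_w'| <= x.  Let |r_i| lie in [mu, rho], mu > 1.

Growth rate.  Cutting a word at the first prefix whose slope reaches x
([split_word]) gives N(x y) <= N(rho x) N(y) for x, y >= 1, so log N(rho e^t) is
subadditive in t > 0 and [fekete] yields a real exponent d.  Since the numbers
|f_w'|^(-s) of the words w of a fixed length add up to 1, at most x^s words of
each length have slope at most x; only about log x lengths matter, hence d <= s.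

Orbits.  The slopes of modulus at most x are products of powers of the r_i, so
there are only polynomially many in log x of them, and an affine map is
determined by its slope and its value at a.  As |g(a)| <= C |g'|, the orbit has
at least N(x) / (log x)^O(1) points in [-Cx, Cx], whatever a is
([at_most_orbit_lower]).  Conversely, if f_w(a) lies in [x - h, x + h], cut
w = uv where the slope of u reaches h: then f_v(a) lies within 1 of
f_u^-1(x), and |f_u'| <= rho h.  So the orbit has at most N(rho h) (k + 1)
points there, k bounding its number of points in such a unit ball
([at_most_orbit_upper]).  Uniform local finiteness provides k for every x, plain
local finiteness for x = 0, because f_u^-1(0) stays bounded.  Both
dimensions of the orbit therefore equal d; and a uniformly locally finite set
has O(h) points in an interval of radius h, so that d <= 1.

Box dimension.  Let P(e) be the largest cardinality of a subset of the
attractor K with mutual distances larger than e.  Each point of such a set has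
a copy f_w^-1(K) of K of size comparable to e close to it, so that
P(e e' / kappa) >= P(e) P(e') for some constant kappa and e, e' <= 1
([packing_supermultiplicative]) and Fekete's lemma applies again; P(e) and the
covering numbers of K agree up to a factor 2 in e.
Finally, points of K at distance larger than kappa / x are sent back into K by
distinct maps of slope at most x, so P(kappa / x) <= N(x) and the box dimension
is at most d.

These comparisons between counting functions hold up to constants,
rescalings of the variable and subpolynomial factors; [exponent_le] and
[exponent_ge] express growth rates modulo such errors. *)

(** * Cardinality bounds *)

Section Cardinality.

(** A has at most n elements: it is contained in a list of length at most n. *)
Definition at_most {T : choiceType} (A : set T) (n : nat) : Prop :=
  exists2 s : seq T, (size s <= n)%N & A `<=` [set` s].

Lemma at_mostW (T : choiceType) (A B : set T) (n k : nat) :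
  A `<=` B -> (n <= k)%N -> at_most B n -> at_most A k.
Proof.
move=> AB nk [s sn Bs]; exists s; first exact: leq_trans nk.
exact: subset_trans Bs.
Qed.

Lemma at_most_finite (T : choiceType) (A : set T) (n : nat) :
  at_most A n -> finite_set A.
Proof. by move=> [s _ As]; apply: sub_finite_set As _; exact: finite_seq. Qed.

Lemma at_mostE (T : choiceType) (A : set T) (n : nat) :
  at_most A n <-> finite_set A /\ (#|` fset_set A| <= n)%N.
Proof.
split=> [An|[finA An]]; last first.
  exists (fset_set A : seq T) => // x Ax /=.
  by rewrite in_fset_set // inE.
have finA := at_most_finite _ _ _ An; split=> //.
have [s sn As] := An; apply: leq_trans sn.
apply: uniq_leq_size; first exact: fset_uniq.
by move=> x; rewrite in_fset_set // inE => /As.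
Qed.

Lemma at_most_counting (R : realType) (T : choiceType) (A : set T) (n : nat) :
  at_most A n -> (@counting T R A <= n%:R%:E)%E.
Proof.
by move=> /at_mostE[finA An]; rewrite /counting asboolT // lee_fin ler_nat.
Qed.

Lemma at_most_image (T U : choiceType) (f : T -> U) (A : set T) (n : nat) :
  at_most A n -> at_most (f @` A) n.
Proof.
move=> [s sn As]; exists (map f s); first by rewrite size_map.
by move=> _ [x Ax <-] /=; apply: map_f; exact: As.
Qed.

Lemma at_most_bigcup (T U : choiceType) (A : set T) (B : T -> set U) (n k : nat) :
  at_most A n -> (forall x, A x -> at_most (B x) k) ->
  at_most (\bigcup_(x in A) B x) (n * k)%N.
Proof.
move=> [s sn As] Bk.
have /choice[t tP] : forall x, exists t : seq U,
    A x -> (size t <= k)%N /\ B x `<=` [set` t].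
  move=> x; have [Ax|nAx] := pselect (A x); last by exists [::].
  by have [t tk Bt] := Bk _ Ax; exists t.
pose s' := [seq x <- s | `[< A x >]].
exists (flatten (map t s')).
  apply: (@leq_trans (size s' * k)).
    have : all (fun x => `[< A x >]) s' by rewrite filter_all.
    elim: s' => //= x s' IH /andP[/asboolP Ax /IH sk].
    by rewrite size_cat mulSn leq_add //; case: (tP _ Ax).
  by rewrite leq_mul2r (leq_trans _ sn) ?orbT // size_filter count_size.
move=> y [x Ax Bxy] /=; apply/flatten_mapP; exists x; last by case: (tP _ Ax) => _; apply.
by rewrite mem_filter asboolT //=; exact: As.
Qed.

Lemma counting_infty (R : realType) (T : choiceType) (A : set T) :
  ~ finite_set A -> @counting T R A = +oo%E.
Proof. by move=> infA; rewrite /counting asboolF. Qed.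

Lemma counting_at_most (R : realType) (T : choiceType) (A : set T) (c : R) :
  (@counting T R A <= c%:E)%E -> exists2 n, at_most A n & n%:R <= c.
Proof.
rewrite /counting; case: asboolP => // finA; rewrite lee_fin => Ac.
by exists #|` fset_set A| => //; apply/at_mostE.
Qed.

Lemma counting_ge0 (R : realType) (T : choiceType) (A : set T) :
  (0 <= @counting T R A)%E.
Proof. by rewrite /counting; case: ifP => _; rewrite ?lee_fin ?leey. Qed.

Lemma le_counting (R : realType) (T : choiceType) (A B : set T) :
  A `<=` B -> (@counting T R A <= counting B)%E.
Proof.
move=> AB; have [finB|infB] := pselect (finite_set B).
  rewrite [leRHS]/counting asboolT //; apply: at_most_counting.
  by apply: at_mostW AB (leqnn _) _; apply/at_mostE.
by rewrite (counting_infty _ _ _ infB) leey.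
Qed.

Lemma at_most_II (n : nat) : at_most `I_n n.
Proof.
by exists (iota 0 n) => [|k kn]; rewrite ?size_iota // /mkset mem_iota.
Qed.

End Cardinality.

(** * Fekete's lemma *)

Section Fekete.
Context {R : realType}.

(** Subadditivity is only required beyond t0; local boundedness from above
replaces the regularity that a function of a real variable needs. *)
Lemma fekete (u : R -> R) (t0 A : R) :
  0 < t0 ->
  (forall s t, t0 <= s -> t0 <= t -> u (s + t) <= u s + u t) ->
  (forall T, exists M, forall t, t0 <= t <= T -> u t <= M) ->
  (forall t, t0 <= t -> - (A * t) <= u t) ->
  exists L : R, u t / t @[t --> +oo] --> L.
Proof.
move=> t0_gt0 usub ubdd ulow.
pose E := [set u t / t | t in [set t | t0 <= t]].
have Einf : has_inf E.
  split; first by exists (u t0 / t0); exists t0 => //=.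
  exists (- A) => _ [t /= t0t <-].
  by rewrite ler_pdivlMr ?(lt_le_trans t0_gt0) // mulNr ulow.
exists (inf E); apply/cvgrPdist_le => e e_gt0.
have [_ [T /= t0T <-] ET] := @inf_adherent _ E (e / 2) (divr_gt0 e_gt0 (ltr0Sn _ 1)) Einf.
(* The function v is subadditive and v T <= 0, so that its values on [T, 2T]
   bound it everywhere beyond T. *)
pose c := inf E + e / 2; pose v t := u t - c * t.
have T_gt0 : 0 < T by exact: lt_le_trans t0T.
have vT : v T <= 0.
  by rewrite subr_le0 -ler_pdivrMr // ltW.
have [M0 M0P] := ubdd (T * 2).
pose M := `|M0| + `|c| * (T * 2).
have vM n t : T <= t <= T * n.+2%:R -> v t <= M.
  elim: n t => [|n IH] t /andP[Tt tT].
    rewrite /v /M lerD //.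
      by apply: le_trans (ler_norm _); apply: M0P; rewrite tT (le_trans t0T).
    have t_ge0 : 0 <= t by rewrite (le_trans _ Tt) // ltW.
    apply: (@le_trans _ _ (`|c| * t)); last by rewrite ler_wpM2l.
    by rewrite -mulNr ler_wpM2r // -normrN ler_norm.
  have [t2|t2] := leP t (T * n.+2%:R); first by apply: IH; rewrite Tt.
  have T1 : T <= t - T.
    have n2 : 2 <= n.+2%:R :> R by rewrite ler_nat.
    by nra.
  have -> : t = T + (t - T) by rewrite addrC subrK.
  apply: (@le_trans _ _ (v T + v (t - T))).
    rewrite /v mulrDr opprD addrACA lerD2r usub //.
    exact: le_trans T1.
  rewrite -[leRHS]add0r lerD // IH // T1 lerBlDr /=.
  by rewrite (le_trans tT) // -[n.+3]addn1 natrD; lra.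
near=> t.
have Tt : T <= t by near: t; apply: nbhs_pinfty_ge; exact: num_real.
have t_gt0 : 0 < t by exact: lt_le_trans Tt.
have Et : inf E <= u t / t.
  by apply: ge_inf; [case: Einf|exists t => //=; exact: le_trans Tt].
rewrite distrC ger0_norm ?subr_ge0 // lerBlDr ler_pdivrMr //.
have vt : v t <= M.
  apply: (vM (Num.trunc (t / T))); rewrite Tt /= mulrC -ler_pdivrMr //.
  rewrite ltW // (lt_le_trans (truncnS_gt _)) // ler_nat //.
have Mt : M <= e / 2 * t.
  by rewrite mulrC -ler_pdivrMr ?divr_gt0 //; near: t; apply: nbhs_pinfty_ge; exact: num_real.
move: vt; rewrite /v lerBlDr => /le_trans; apply.
rewrite (le_trans (lerD Mt (lexx _))) // -mulrDl ler_pM2r // /c.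
lra.
Unshelve. all: by end_near. Qed.

End Fekete.

(** * Words and the affine maps they induce *)

Section Words.
Context {R : realType} {m : nat} (r b : 'I_m -> R).

Local Notation wmap := (word_map (affine_system r b)).

(** The linear coefficient of the map induced by w. *)
Definition slope (w : seq 'I_m) : R := \prod_(i <- w) r i.

Lemma slope_cat (u v : seq 'I_m) : slope (u ++ v) = slope u * slope v.
Proof. by rewrite /slope big_cat. Qed.

Lemma slope_nil : slope [::] = 1.
Proof. by rewrite /slope big_nil. Qed.

Lemma slope_cons (i : 'I_m) (w : seq 'I_m) : slope (i :: w) = r i * slope w.
Proof. by rewrite /slope big_cons. Qed.

Lemma word_map_cat (u v : seq 'I_m) (x : R) :
  wmap (u ++ v) x = wmap u (wmap v x).
Proof. by elim: u => //= i u IH; rewrite IH. Qed.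

Lemma word_mapE (w : seq 'I_m) (x : R) : wmap w x = slope w * x + wmap w 0.
Proof.
elim: w x => [|i w IH] x /=; first by rewrite slope_nil mul1r addr0.
by rewrite IH /affine_system /= slope_cons; ring.
Qed.

Lemma word_mapB (w : seq 'I_m) (x y : R) :
  wmap w x - wmap w y = slope w * (x - y).
Proof. by rewrite word_mapE (word_mapE w y); ring. Qed.

Lemma linear_coef_word (w : seq 'I_m) : linear_coef (wmap w) = slope w.
Proof. by rewrite /linear_coef word_mapB subr0 mulr1. Qed.

(** The maps of slope at most x induced by words, the empty word (that is, the
identity) included: this makes the set stable under cutting words. *)
Definition maps_upto (x : R) : set (R -> R) :=
  [set wmap w | w in [set w | `|slope w| <= x]].

(** The elements of the semigroup of slope at most x. *)
Definition growth_set (x : R) : set (R -> R) :=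
  [set g | generated_semigroup (affine_system r b) g /\ `|linear_coef g| <= x].

Lemma growth_setP (x : R) (w : seq 'I_m) :
  w != [::] -> `|slope w| <= x -> growth_set x (wmap w).
Proof. by move=> w0 wx; split; [exists w|rewrite linear_coef_word]. Qed.

Lemma growth_set_sub (x : R) : growth_set x `<=` maps_upto x.
Proof.
by move=> _ [[w /= _ <-]]; rewrite linear_coef_word => wx; exists w.
Qed.

Lemma at_most_maps_upto (x : R) (n : nat) :
  at_most (growth_set x) n -> at_most (maps_upto x) n.+1.
Proof.
move=> [s sn Gs]; exists (wmap [::] :: s) => // _ [w /= wx <-].
have [->|w0] := eqVneq w [::]; first by rewrite inE eqxx.
by rewrite inE; apply/orP; right; apply: Gs; exact: growth_setP.
Qed.

Lemma slope_count (w : seq 'I_m) :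
  slope w = \prod_(i < m) r i ^+ count_mem i w.
Proof.
elim: w => [|i w IH] /=; first by rewrite slope_nil big1.
rewrite slope_cons IH.
under eq_bigr do rewrite exprD.
rewrite big_split /=; congr (_ * _).
rewrite (bigD1 i) //= eqxx expr1 big1 ?mulr1 // => j /negPf ji.
by rewrite eq_sym ji.
Qed.

Context (mu rho : R) (mu_gt1 : 1 < mu) (rho_ge1 : 1 <= rho)
  (r_ge : forall i, mu <= `|r i|) (r_le : forall i, `|r i| <= rho).

Let mu_gt0 : 0 < mu := lt_trans ltr01 mu_gt1.

Lemma slope_ge (w : seq 'I_m) : mu ^+ size w <= `|slope w|.
Proof.
elim: w => [|i w IH] /=; first by rewrite slope_nil expr0 normr1.
by rewrite slope_cons normrM exprS ler_pM // ?exprn_ge0 // ltW.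
Qed.

Lemma slope_ge1 (w : seq 'I_m) : 1 <= `|slope w|.
Proof. by rewrite (le_trans _ (slope_ge w)) // exprn_ege1 // ltW //. Qed.

Lemma r_neq0 (i : 'I_m) : r i != 0.
Proof. by rewrite -normr_gt0 (lt_le_trans mu_gt0). Qed.

Lemma slope_neq0 (w : seq 'I_m) : slope w != 0.
Proof. by rewrite -normr_gt0 (lt_le_trans ltr01) // slope_ge1. Qed.

(** Upper bound for the length of the words of slope at most x, see
[size_le_max_length]. *)
Definition max_length (x : R) : nat := Num.trunc (ln x / ln mu).

Lemma size_le_max_length (x : R) (w : seq 'I_m) :
  `|slope w| <= x -> (size w <= max_length x)%N.
Proof.
move=> wx; have lnmu := ln_gt0 mu_gt1.
have x1 : 1 <= x by apply: le_trans wx; exact: slope_ge1.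
rewrite -ltnS -(ltr_nat R) (le_lt_trans _ (truncnS_gt _)) //.
rewrite ler_pdivlMr // mulr_natl -lnXn //.
rewrite ler_ln ?posrE ?exprn_gt0 ?(lt_le_trans _ x1) //.
by apply: le_trans wx; exact: slope_ge.
Qed.

(** The slope only depends on the number of occurrences of each letter, which is
at most the length of the word. *)
Lemma at_most_slopes (x : R) :
  at_most [set slope w | w in [set w | `|slope w| <= x]]
    ((max_length x).+1 ^ m)%N.
Proof.
pose L := max_length x.
exists [seq \prod_(i < m) r i ^+ f i
         | f : {ffun 'I_m -> 'I_L.+1} <- enum {: {ffun 'I_m -> 'I_L.+1}}].
  by rewrite size_map -cardE card_ffun !card_ord.
move=> _ [w /= /size_le_max_length wL <-]; apply/mapP.
exists [ffun i => inord (count_mem i w)]; first by rewrite mem_enum.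
rewrite slope_count; apply: eq_bigr => i _; rewrite ffunE inordK //.
by rewrite ltnS (leq_trans (count_size _ _)).
Qed.

Fixpoint words_of_size (n : nat) : seq (seq 'I_m) :=
  if n is k.+1 then [seq i :: w | i <- enum 'I_m, w <- words_of_size k]
  else [:: [::]].

Lemma mem_words_of_size (w : seq 'I_m) : w \in words_of_size (size w).
Proof.
by elim: w => //= i w IH; apply/allpairsP; exists (i, w); rewrite mem_enum.
Qed.

(** The words of slope at most x are sorted by length; k bounds the number of
them of any given length. *)
Lemma at_most_growth (x : R) (k : nat) :
  (forall n, count (fun w => `|slope w| <= x)%R (words_of_size n) <= k)%N ->
  at_most (maps_upto x) ((max_length x).+1 * k).
Proof.
move=> wk.
pose B n := wmap @` [set w | w \in words_of_size n /\ `|slope w| <= x].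
apply: (@at_mostW _ _ (\bigcup_(n in `I_(max_length x).+1) B n) _ _ _ (leqnn _)).
  move=> _ [w /= wx <-]; exists (size w); first exact: size_le_max_length.
  by exists w => //; split=> //; exact: mem_words_of_size.
apply: at_most_bigcup; first exact: at_most_II.
move=> n _; apply: at_most_image.
exists [seq w <- words_of_size n | `|slope w| <= x]; first by rewrite size_filter.
by move=> w [/= wn wx]; rewrite mem_filter wx.
Qed.

Lemma finite_maps_upto (x : R) : exists n, at_most (maps_upto x) n.
Proof.
pose M := (\max_(n < (max_length x).+1) size (words_of_size n))%N.
exists ((max_length x).+1 * M)%N; apply: at_most_growth => n.
have size_words w : w \in words_of_size n -> size w = n.
  elim: n w => [|n IH] w /=; first by rewrite inE => /eqP ->.
  by move=> /allpairsP[[i v] /= [_ /IH <- ->]].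
have [nL|Ln] := ltnP n (max_length x).+1.
  by rewrite (leq_trans (count_size _ _)) // (leq_bigmax (Ordinal nL)).
rewrite (_ : count _ _ = 0%N) //; apply/eqP; rewrite -leqn0 leqNgt -has_count.
apply/negP => /hasP[w /size_words wn /size_le_max_length].
by rewrite wn leqNgt Ln.
Qed.

Lemma sum_powR_words (s : R) (n : nat) : \sum_(i < m) `|r i| `^ (- s) = 1 ->
  \sum_(w <- words_of_size n) `|slope w| `^ (- s) = 1.
Proof.
move=> hs; elim: n => [|n IH] /=.
  by rewrite big_seq1 slope_nil normr1 powR1.
rewrite big_allpairs_dep /= -[RHS]hs big_enum /=; apply: eq_bigr => i _.
rewrite -[RHS]mulr1 -IH mulr_sumr; apply: eq_bigr => w _.
by rewrite slope_cons normrM powRM.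
Qed.

Lemma count_words_le (s x : R) (n : nat) : 0 <= s -> 0 < x ->
  \sum_(i < m) `|r i| `^ (- s) = 1 ->
  (count (fun w => `|slope w| <= x) (words_of_size n))%:R <= x `^ s.
Proof.
move=> s0 x0 hs; rewrite -[leRHS]mul1r -ler_pdivrMr ?powR_gt0 // -powRN.
rewrite -sum1_count natr_sum mulr_suml -[leRHS](sum_powR_words _ n hs).
rewrite [leRHS](bigID (fun w => `|slope w| <= x)) /= -[leLHS]addr0.
apply: lerD; last by apply: sumr_ge0 => w _; exact: powR_ge0.
apply: ler_sum => w wx; rewrite mul1r !powRN lef_pV2 ?posrE ?powR_gt0 //.
  by apply: ge0_ler_powR; rewrite ?nnegrE // ltW.
by rewrite normr_gt0 slope_neq0.
Qed.

(** u is the first prefix of w of slope at least h, or w itself if there is none;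
one letter multiplies the slope by at most rho. *)
Lemma split_word (h : R) (w : seq 'I_m) : 1 <= h ->
  exists u v, [/\ w = u ++ v, `|slope u| <= rho * h &
    v = [::] \/ h <= `|slope u|].
Proof.
move=> h1; have rho0 : 0 < rho by rewrite (lt_le_trans ltr01).
elim/last_ind: w => [|w i [u [v [-> urho [v0|hu]]]]].
- exists [::], [::]; split; [by []| |by left].
  by rewrite slope_nil normr1 mulr_ege1.
- rewrite v0 cats0; have [hu|uh] := leP h `|slope u|.
    by exists u, [:: i]; split; [rewrite cats1|by []|right].
  exists (rcons u i), [::]; rewrite cats0; split; [by []| |by left].
  rewrite -cats1 slope_cat slope_cons slope_nil mulr1 normrM mulrC.
  by rewrite ler_pM // ltW.
- by exists u, (rcons v i); split; [rewrite rcons_cat|by []|right].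
Qed.

Lemma at_most_mapsM (x y : R) (n k : nat) : 1 <= x -> 1 <= y ->
  at_most (maps_upto (rho * x)) n -> at_most (maps_upto y) k ->
  at_most (maps_upto (x * y)) (n * k)%N.
Proof.
move=> x1 y1 xn yk.
pose B (g : R -> R) := [set g \o h | h in maps_upto y].
apply: (@at_mostW _ _ (\bigcup_(g in maps_upto (rho * x)) B g) _ _ _ (leqnn _)).
  move=> _ [w /= wxy <-]; have [u [v [wuv ux vu]]] := split_word _ w x1.
  exists (wmap u); first by exists u.
  exists (wmap v).
    exists v => //=; case: vu => [->|xu]; first by rewrite slope_nil normr1.
    rewrite -(ler_pM2l (lt_le_trans ltr01 x1)) (le_trans _ wxy) //.
    by rewrite wuv slope_cat normrM ler_wpM2r.
  by apply/funext => z; rewrite wuv word_map_cat.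
by apply: at_most_bigcup => // g _; exact: at_most_image.
Qed.

Section Orbit.
Context (beta : R) (beta_ge0 : 0 <= beta) (b_le : forall i, `|b i| <= beta).

(* All the f_w^-1(0) lie in [-A, A], see [word_map0_le]. *)
Let A : R := beta / (mu - 1).

Let A_ge0 : 0 <= A.
Proof. by rewrite divr_ge0 // subr_ge0 ltW. Qed.

Lemma word_map0_le (w : seq 'I_m) :
  `|wmap w 0| <= beta / (mu - 1) * `|slope w|.
Proof.
(* The stronger bound is the one that passes to w followed by a letter. *)
suff : `|wmap w 0| <= A * (`|slope w| - 1).
  by move=> /le_trans; apply; rewrite ler_wpM2l // gerBl.
elim/last_ind: w => [|w i IH] /=.
  by rewrite slope_nil normr0 normr1 subrr mulr0.
rewrite -cats1 word_map_cat word_mapE slope_cat normrM.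
rewrite slope_cons slope_nil mulr1 (le_trans (ler_normD _ _)) // normrM.
rewrite /= /affine_system mulr0 add0r.
have Amu : A * (mu - 1) = beta by rewrite mulfVK // subr_eq0 gt_eqF.
have bA : `|b i| <= A * (`|r i| - 1).
  by rewrite (le_trans (b_le i)) // -Amu ler_wpM2l // lerB.
have := ler_wpM2l (normr_ge0 (slope w)) bA.
by lra.
Qed.

(** Holds because an affine map is determined by its slope and its value at a. *)
Lemma at_most_orbit_lower (a x : R) (k : nat) :
  at_most (forward_orbit (affine_system r b) a `&`
           `[0 - (`|a| + A) * x, 0 + (`|a| + A) * x]) k ->
  at_most (growth_set x) ((max_length x).+1 ^ m * k).
Proof.
move=> Ok; set C := `|a| + A; set E := _ `&` _ in Ok.
pose B (c : R) : set (R -> R) := [set (fun z => c * (z - a) + y) | y in E].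
apply: (@at_mostW _ _ (\bigcup_(c in [set slope w | w in [set w | `|slope w| <= x]])
   B c) _ _ _ (leqnn _)); last first.
  by apply: at_most_bigcup; [exact: at_most_slopes|move=> c _; exact: at_most_image].
move=> _ [[w /= w0 <-]]; rewrite linear_coef_word => wx.
exists (slope w); first by exists w.
exists (wmap w a); last by apply/funext => z; rewrite -word_mapB subrK.
split; first by exists (wmap w) => //; exists w.
have x_ge0 : 0 <= x by exact: le_trans wx.
rewrite /= in_itv /= sub0r add0r -ler_norml word_mapE.
rewrite (le_trans (ler_normD _ _)) // normrM mulrDl lerD //.
  by rewrite mulrC ler_wpM2l.
by rewrite (le_trans (word_map0_le _)) // ler_wpM2l.
Qed.

(** Each orbit point f_w(a) near x is f_u(y), where u is a prefix of w as in
[split_word] and y is a (empty remainder) or an orbit point within 1 of the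
preimage of x under f_u. *)
Lemma at_most_orbit_upper (a x h : R) (n k : nat) : 1 <= h ->
  at_most (maps_upto (rho * h)) n ->
  (forall u, at_most (forward_orbit (affine_system r b) a `&`
     `[(x - wmap u 0) / slope u - 1, (x - wmap u 0) / slope u + 1]) k) ->
  at_most (forward_orbit (affine_system r b) a `&` `[x - h, x + h]) (n * k.+1).
Proof.
move=> h1 hn Ok; set O := forward_orbit _ a.
have h0 : 0 < h by exact: lt_le_trans h1.
pose B (g : R -> R) :=
  [set g y | y in [set y | y = a \/ O y /\ `|x - g y| <= h /\ h <= `|linear_coef g|]].
apply: (@at_mostW _ _ (\bigcup_(g in maps_upto (rho * h)) B g) _ _ _ (leqnn _)).
  move=> _ [[_ [w /= w0 <-] <-]]; rewrite /= in_itv /= -ler_distlC => wxh.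
  have [u [v [wuv urho vu]]] := split_word _ w h1.
  exists (wmap u); first by exists u.
  rewrite wuv word_map_cat; exists (wmap v a) => //=.
  have [v0|v0] := eqVneq v [::]; first by left; rewrite v0.
  right; split; first by exists (wmap v) => //; exists v.
  rewrite -word_map_cat -wuv; split=> //.
  by case: vu v0 => [->//|hu _]; rewrite linear_coef_word.
apply: at_most_bigcup => // _ [u /= urho <-].
apply: at_most_image.
have [s sk Es] := Ok u; exists (a :: s) => // y [->|[Oy [yxh hu]]] /=.
  exact: mem_head.
rewrite inE; apply/orP; right; apply: Es; split=> //=.
rewrite in_itv /= -ler_distlC.
rewrite linear_coef_word in hu.
have -> : (x - wmap u 0) / slope u - y = (x - wmap u y) / slope u.
  rewrite (word_mapE u y); field; exact: slope_neq0.
rewrite normrM normfV ler_pdivrMr ?normr_gt0 ?slope_neq0 // mul1r.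
exact: le_trans hu.
Qed.

End Orbit.

End Words.

(** * Polynomial growth exponents *)

Section Exponents.
Context {R : realType}.
Implicit Types (f : R -> \bar R) (g : R -> R).

(** The upper growth exponent limsup log f(x) / log x at infinity is at most d. *)
Definition exponent_le f (d : R) : Prop :=
  forall e, 0 < e -> \forall x \near +oo, (f x <= (x `^ (d + e))%:E)%E.

(** The lower growth exponent liminf log f(x) / log x at infinity is at least d. *)
Definition exponent_ge f (d : R) : Prop :=
  forall e, 0 < e -> \forall x \near +oo, ((x `^ (d - e))%:E <= f x)%E.

Lemma near_ge (A : R) : \forall x \near +oo, A <= x.
Proof. by apply: nbhs_pinfty_ge; exact: num_real. Qed.

Lemma near_powR_ge (C e : R) : 0 < e -> \forall x \near +oo, C <= x `^ e.
Proof.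
move=> e0; near=> x.
have x0 : 0 < x by apply: (@lt_le_trans _ _ 1) => //; near: x; exact: near_ge.
have Cx : (`|C| + 1) `^ e^-1 <= x by near: x; exact: near_ge.
apply: (@le_trans _ _ (`|C| + 1)).
  by rewrite (le_trans (ler_norm _)) // lerDl.
have C1 : 0 <= `|C| + 1 by rewrite addr_ge0.
rewrite -[leLHS](powRr1 C1) -[X in _ `^ X](mulVf (lt0r_neq0 e0)) powRrM.
by apply: ge0_ler_powR; rewrite ?nnegrE ?powR_ge0 // ltW.
Unshelve. all: by end_near. Qed.

Lemma near_scale (k : R) (P : R -> Prop) : 0 < k ->
  (\forall x \near +oo, P x) -> \forall x \near +oo, P (k * x).
Proof.
move=> k0 [A [_ AP]]; exists (A / k); split; first exact: num_real.
by move=> x Ax; apply: AP; rewrite mulrC -ltr_pdivrMr.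
Qed.

Lemma near_ln (P : R -> Prop) :
  (\forall t \near +oo, P t) -> \forall x \near +oo, P (ln x).
Proof.
move=> [A [_ AP]]; exists (expR A); split; first exact: num_real.
by move=> x Ax; apply: AP; rewrite -ltr_expR lnK // posrE (lt_trans _ Ax) // expR_gt0.
Qed.

Lemma near_gt0 : \forall x \near +oo, 0 < (x : R).
Proof. by apply: nbhs_pinfty_gt; exact: num_real. Qed.

Lemma exponent_le_scale f g (d C k : R) : 0 <= C -> 0 < k ->
  exponent_le (EFin \o g) d ->
  (\forall x \near +oo, (f x <= (C * g (k * x))%:E)%E) -> exponent_le f d.
Proof.
move=> C0 k0 gd fg e e0.
have e2 : 0 < e / 2 by rewrite divr_gt0.
have gk := near_scale _ _ k0 (gd _ e2).
have Ck := near_powR_ge (C * k `^ (d + e / 2)) _ e2.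
near=> x.
have x0 : 0 < x by near: x; exact: near_gt0.
have fx : (f x <= (C * g (k * x))%:E)%E by near: x.
have gx : g (k * x) <= (k * x) `^ (d + e / 2) by rewrite -lee_fin; near: x.
have Cx : C * k `^ (d + e / 2) <= x `^ (e / 2) by near: x.
apply: (le_trans fx); rewrite lee_fin.
have -> : d + e = e / 2 + (d + e / 2) by field.
rewrite powRD ?(gt_eqF x0) ?implybT //.
apply: (le_trans (ler_wpM2l C0 gx)).
by rewrite powRM ?(ltW k0) ?(ltW x0) // mulrA ler_wpM2r ?powR_ge0.
Unshelve. all: by end_near. Qed.

(** L is a subpolynomial factor.  The last hypothesis says g(k x) <= L(x) f(x); it
is phrased with the real upper bounds c of f(x) because f(x) may be infinite. *)
Lemma exponent_ge_scale f g (L : R -> R) (d k : R) : 0 < k ->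
  exponent_ge (EFin \o g) d ->
  (forall e, 0 < e -> \forall x \near +oo, L x <= x `^ e) ->
  (\forall x \near +oo, forall c, (f x <= c%:E)%E -> g (k * x) <= L x * c) ->
  exponent_ge f d.
Proof.
move=> k0 gd Le fg e e0.
have e3 : 0 < e / 3 by rewrite divr_gt0.
have gk := near_scale _ _ k0 (gd _ e3).
have Ck := near_powR_ge ((k `^ (d - e / 3))^-1 + 1) _ e3.
have Lx := Le _ e3.
near=> x.
have x0 : 0 < x by near: x; exact: near_gt0.
rewrite leNgt; apply/negP => /ltW fx.
have gx : g (k * x) <= L x * x `^ (d - e) by apply: (near fg x).
have gx' : (k * x) `^ (d - e / 3) <= g (k * x) by rewrite -lee_fin; near: x.
have Cx : (k `^ (d - e / 3))^-1 + 1 <= x `^ (e / 3) by near: x.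
have Lx' : L x <= x `^ (e / 3) by near: x.
have := le_trans gx' (le_trans gx (ler_wpM2r (powR_ge0 _ _) Lx')).
have xE : x `^ (d - e / 3) = x `^ (e / 3) * x `^ (d - e) * x `^ (e / 3).
  by rewrite -!powRD ?(gt_eqF x0) ?implybT //; congr (_ `^ _); field.
rewrite powRM ?(ltW k0) ?(ltW x0) // xE.
set p := x `^ (e / 3) in Cx *; set q := x `^ (d - e); set c := k `^ _ in Cx *.
have q0 : 0 < q by exact: powR_gt0.
have p0 : 0 < p by exact: powR_gt0.
have c0 : 0 < c by exact: powR_gt0.
have cp : 1 < c * p.
  rewrite mulrC -ltr_pdivrMr // div1r (lt_le_trans _ Cx) // ltrDl //.
move=> pq; suff : p * q < c * (p * q * p) by rewrite ltNge pq.
have -> : c * (p * q * p) = (c * p) * (p * q) by ring.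
by rewrite ltr_pMl // mulr_gt0.
Unshelve. all: by end_near. Qed.

Lemma exponent_le_trans f d d' : exponent_ge f d -> exponent_le f d' -> d <= d'.
Proof.
move=> fd fd'; rewrite leNgt; apply/negP => dd'.
have e3 : 0 < (d - d') / 3 by rewrite divr_gt0 // subr_gt0.
have lo := fd _ e3; have up := fd' _ e3.
have F : ProperFilter (nbhs (pinfty_nbhs R)) by exact: proper_pinfty_nbhs.
have [x [x1 []]] : exists x, 1 < x /\
    ((x `^ (d - (d - d') / 3))%:E <= f x)%E /\ (f x <= (x `^ (d' + (d - d') / 3))%:E)%E.
  near (pinfty_nbhs R) => x; exists x; split.
    by near: x; apply: nbhs_pinfty_gt; exact: num_real.
  by split; near: x.
move=> /le_trans/[apply]; rewrite lee_fin /powR gt_eqF ?(lt_trans _ x1) //.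
rewrite ler_expR ler_pM2r ?ln_gt0 //; lra.
Unshelve. all: by end_near. Qed.

Lemma exponent_lim f d : exponent_ge f d -> exponent_le f d ->
  (lne (f x) / (ln x)%:E)%E @[x --> +oo] --> d%:E.
Proof.
move=> fge fle.
have fE (e : R) : 0 < e -> \forall x \near +oo,
    exists2 q : R, (lne (f x) / (ln x)%:E)%E = q%:E & `|d - q| <= e.
  move=> e0; have lo := fge _ e0; have up := fle _ e0; near=> x.
  have x1 : 1 < x by near: x; apply: nbhs_pinfty_gt; exact: num_real.
  have x0 : 0 < x by exact: lt_trans x1.
  have lnx := ln_gt0 x1.
  have lox : ((x `^ (d - e))%:E <= f x)%E by near: x.
  have upx : (f x <= (x `^ (d + e))%:E)%E by near: x.
  move: lox upx; case: (f x) => [y| |] //; rewrite !lee_fin => lox upx.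
  have y0 : 0 < y by rewrite (lt_le_trans _ lox) // powR_gt0.
  exists (ln y / ln x); first by rewrite lne_EFin // inver gt_eqF.
  rewrite ler_distlC ler_pdivlMr // ler_pdivrMr // -!ln_powR.
  rewrite !ler_ln ?posrE ?powR_gt0 //; apply/andP; split=> //.
apply/fine_cvgP; split.
  by near=> x; have [|q -> //] := near (fE 1 ltr01) x.
apply/cvgrPdist_le => e e0; near=> x.
by have [|q /= -> //] := near (fE e e0) x.
Unshelve. all: by end_near. Qed.

Lemma exponent_of_lim (u : R -> R) (d : R) : u t / t @[t --> +oo] --> d ->
  exponent_ge (fun x => (expR (u (ln x)))%:E) d /\
  exponent_le (fun x => (expR (u (ln x)))%:E) d.
Proof.
move=> /cvgrPdist_le ud.
suff H (e : R) : 0 < e -> \forall x \near +oo, (d - e) * ln x <= u (ln x) <= (d + e) * ln x.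
  split=> e e0; have He := H e e0; near=> x.
    have x0 : 0 < x by near: x; exact: near_gt0.
    rewrite lee_fin /powR gt_eqF // ler_expR.
    by have /andP[] : (d - e) * ln x <= u (ln x) <= (d + e) * ln x by near: x.
  have x0 : 0 < x by near: x; exact: near_gt0.
  rewrite lee_fin /powR gt_eqF // ler_expR.
  by have /andP[] : (d - e) * ln x <= u (ln x) <= (d + e) * ln x by near: x.
move=> e0; have ude := ud e e0.
apply: (near_ln (fun t => (d - e) * t <= u t <= (d + e) * t)); near=> t.
have t0 : 0 < t by near: t; exact: near_gt0.
have : `|d - u t / t| <= e by near: t.
by rewrite ler_distlC ler_pdivlMr // ler_pdivrMr // => /andP[-> ->].
Unshelve. all: by end_near. Qed.

Lemma ln_le_powR (p x : R) : 0 < p -> 1 <= x -> ln x <= x `^ p / p.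
Proof.
move=> p0 x1; rewrite ler_pdivlMr // mulrC -ln_powR ltW // ln_sublinear //.
by rewrite powR_gt0 // (lt_le_trans ltr01).
Qed.

Lemma near_ln_powR (mu e : R) (m : nat) : 1 < mu -> 0 < e ->
  \forall x \near +oo, ((max_length mu x).+1 ^ m)%:R <= x `^ e.
Proof.
move=> mu1 e0; pose p := e / (2 * m.+1%:R).
have p0 : 0 < p by rewrite divr_gt0 // mulr_gt0.
have lnmu := ln_gt0 mu1.
have Ck := near_powR_ge ((p * ln mu)^-1 + 1) _ p0.
near=> x.
have x1 : 1 <= x by near: x; exact: near_ge.
have x0 : 0 < x by exact: lt_le_trans x1.
have Cx : (p * ln mu)^-1 + 1 <= x `^ p by near: x.
have xp1 : 1 <= x `^ p by rewrite -(powRr0 x) ler_powR // ltW.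
have Lx : (max_length mu x).+1%:R <= x `^ p * x `^ p.
  rewrite -natr1 (le_trans _ (ler_wpM2r (powR_ge0 x p) Cx)) //.
  rewrite mulrDl mul1r lerD // (@le_trans _ _ (ln x / ln mu)) //.
    by rewrite truncn_le // divr_ge0 ?ln_ge0 // ltW.
  have -> : (p * ln mu)^-1 * x `^ p = x `^ p / p / ln mu by rewrite invfM mulrC mulrA.
  by rewrite ler_wpM2r ?invr_ge0 ?(ltW lnmu) // ln_le_powR.
rewrite -powRD ?(gt_eqF x0) ?implybT // in Lx.
rewrite natrX.
rewrite (le_trans (lerXn2r _ _ _ Lx)) ?nnegrE ?powR_ge0 //.
rewrite -powR_mulrn ?powR_ge0 // -powRrM ler_powR //.
have -> : e = (p + p) * m.+1%:R by rewrite /p; field; rewrite ?pnatr_eq0.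
by rewrite ler_wpM2l ?ler_nat // ltW // addr_gt0.
Unshelve. all: by end_near. Qed.

Lemma limf_esup_powR_lty f (d a : R) : exponent_le f d -> d < a ->
  (limf_esup (fun h => f h / (h `^ a)%:E) (pinfty_nbhs R) < +oo)%E.
Proof.
move=> fd da; have e0 : 0 < a - d by rewrite subr_gt0.
have fa := fd _ e0.
apply: (@le_lt_trans _ _ 1%E); last exact: ltry.
pose V := [set h : R | (0 < h) /\ (f h <= (h `^ a)%:E)%E].
apply: (@le_trans _ _ (ereal_sup [set (f h / (h `^ a)%:E)%E | h in V])).
  apply: ereal_inf_lbound; exists V => //.
  near=> h; split; first by near: h; exact: near_gt0.
  by rewrite -[a](addrNK d) [_ - _ + _]addrC; near: h.
apply: ge_ereal_sup => _ [h [h0 fh] <-].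
have ha : 0 < h `^ a by exact: powR_gt0.
by rewrite inver gt_eqF // lee_pdivrMr // mul1e.
Unshelve. all: by end_near. Qed.

Lemma exponent_ge_ratio f (d a M : R) : exponent_ge f d -> a < d ->
  \forall h \near +oo, (M%:E <= f h / (h `^ a)%:E)%E.
Proof.
move=> fd ad; have e2 : 0 < (d - a) / 2 by rewrite divr_gt0 // subr_gt0.
have fa := fd _ e2; have Mh := near_powR_ge M _ e2.
near=> h.
have h0 : 0 < h by near: h; exact: near_gt0.
have Mx : M <= h `^ ((d - a) / 2) by near: h.
rewrite inver gt_eqF ?powR_gt0 // lee_pdivlMr ?powR_gt0 //.
apply: (@le_trans _ _ (h `^ (d - (d - a) / 2))%:E); last by near: h.
rewrite -EFinM lee_fin (le_trans (ler_wpM2r (powR_ge0 h a) Mx)) //.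
rewrite -powRD ?(gt_eqF h0) ?implybT // le_eqVlt; apply/orP; left.
by apply/eqP; congr (_ `^ _); field.
Unshelve. all: by end_near. Qed.

Lemma limf_einf_powR f (d a : R) : exponent_ge f d -> a < d ->
  limf_einf (fun h => f h / (h `^ a)%:E)%E (pinfty_nbhs R) = +oo%E.
Proof.
move=> fd ad; rewrite limf_einfE; apply: eq_infty => M.
apply: le_ereal_sup_tmp; exists (ereal_inf ((fun h => (f h / (h `^ a)%:E)%E) @`
    [set h | (M%:E <= f h / (h `^ a)%:E)%E])).
  by exists [set h | (M%:E <= f h / (h `^ a)%:E)%E] => //; exact: exponent_ge_ratio fd ad.
by apply: le_ereal_inf_tmp => _ [h Mh <-].
Qed.

Lemma limf_esup_powR f (d a : R) : exponent_ge f d -> a < d ->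
  limf_esup (fun h => f h / (h `^ a)%:E)%E (pinfty_nbhs R) = +oo%E.
Proof.
move=> fd ad; apply: eq_infty => M.
apply: le_ereal_inf_tmp => _ [V FV <-].
have F : ProperFilter (nbhs (pinfty_nbhs R)) by exact: proper_pinfty_nbhs.
have fM := exponent_ge_ratio _ _ _ M fd ad.
have [h [Vh Mh]] := filter_ex (filterI FV fM).
by apply: le_ereal_sup_tmp; exists (f h / (h `^ a)%:E)%E => //; exists h.
Qed.

Lemma limf_einf_powR_lty f (d a : R) : exponent_le f d -> d < a ->
  (limf_einf (fun h => f h / (h `^ a)%:E) (pinfty_nbhs R) < +oo)%E.
Proof.
move=> fd da; have e0 : 0 < a - d by rewrite subr_gt0.
have fa := fd _ e0.
apply: (@le_lt_trans _ _ 1%E); last exact: ltry.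
rewrite limf_einfE; apply: ge_ereal_sup => _ [V FV <-].
have F : ProperFilter (nbhs (pinfty_nbhs R)) by exact: proper_pinfty_nbhs.
have [h [Vh [h0 fh]]] := filter_ex (filterI FV (filterI near_gt0 fa)).
apply: ge_ereal_inf; exists (f h / (h `^ a)%:E)%E; first by exists h.
rewrite addrC subrK in fh.
by rewrite inver gt_eqF ?powR_gt0 // lee_pdivrMr ?powR_gt0 // mul1e.
Qed.

Lemma exponent_ge_infty f (d : R) :
  (\forall h \near +oo, f h = +oo%E) -> exponent_ge f d.
Proof.
move=> foo e e0; near=> h.
have -> : f h = +oo%E by near: h.
exact: leey.
Unshelve. all: by end_near. Qed.

End Exponents.

(** * Growth exponents of submultiplicative functions *)

Section SubmultiplicativeExponent.
Context {R : realType}.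

Lemma submultiplicative_exponent (N : R -> nat) (rho : R) : 1 <= rho ->
  (forall x y, x <= y -> (N x <= N y)%N) ->
  (forall x, 1 <= x -> (0 < N x)%N) ->
  (forall x y, 1 <= x -> 1 <= y -> (N (x * y)%R <= N (rho * x)%R * N y)%N) ->
  exists2 d : R, 0 <= d &
    exponent_ge (fun x => (N x)%:R%:E) d /\ exponent_le (fun x => (N x)%:R%:E) d.
Proof.
move=> rho1 Nmono N0 Nsub.
have rho0 : 0 < rho by exact: lt_le_trans rho1.
have er t : 0 <= t -> 1 <= rho * expR t.
  by move=> t0; rewrite mulr_ege1 // -expR0 ler_expR.
pose u t : R := ln (N (rho * expR t))%:R.
have [d ud] : exists d : R, u t / t @[t --> +oo] --> d.
  apply: (@fekete _ u 1 0) => //.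
  - move=> s t s1 t1; have s0 : 0 <= s by rewrite (le_trans ler01).
    have t0 : 0 <= t by rewrite (le_trans ler01).
    have es : 1 <= expR s by rewrite -expR0 ler_expR.
    rewrite /u -lnM ?posrE ?ltr0n ?N0 ?er // -natrM.
    rewrite ler_ln ?posrE ?ltr0n ?muln_gt0 ?N0 ?er ?addr_ge0 //.
    by rewrite ler_nat expRD mulrCA; apply: Nsub; rewrite ?er.
  - move=> T; exists (u T) => t /andP[t1 tT].
    have t0 : 0 <= t by rewrite (le_trans ler01).
    have T0 : 0 <= T by rewrite (le_trans t0).
    rewrite ler_ln ?posrE ?ltr0n ?N0 ?er // ler_nat Nmono // ler_pM2l //.
    by rewrite ler_expR.
  - move=> t t1; rewrite mul0r oppr0 ln_ge0 // ler1n N0 // er //.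
    by rewrite (le_trans ler01).
have [uge ule] := exponent_of_lim _ _ ud.
have uN x : 1 <= x -> expR (u (ln x)) = (N (rho * x)%R)%:R.
  move=> x1; have x0 : 0 < x by exact: lt_le_trans x1.
  by rewrite /u !lnK ?posrE // ltr0n N0 // mulr_ege1.
have Nge : exponent_ge (fun x => (N x)%:R%:E) d.
  apply: (@exponent_ge_scale _ _ (fun x => expR (u (ln x))) (fun=> 1) _ rho^-1) => //.
  - by rewrite invr_gt0.
  - by move=> e e0; exact: near_powR_ge.
  - near=> x; move=> c; rewrite lee_fin mul1r uN ?mulVKf ?gt_eqF //.
    by rewrite ler_pdivlMl // mulr1; near: x; exact: near_ge.
have Nle : exponent_le (fun x => (N x)%:R%:E) d.
  apply: (@exponent_le_scale _ _ (fun x => expR (u (ln x))) _ 1 1) => //.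
  near=> x; have x1 : 1 <= x by near: x; exact: near_ge.
  by rewrite !mul1r uN // lee_fin ler_nat Nmono // ler_peMl.
exists d => //; apply: exponent_le_trans Nle => e e0; near=> x.
have x1 : 1 <= x by near: x; exact: near_ge.
rewrite lee_fin sub0r powRN (@le_trans _ _ 1) ?ler1n ?N0 //.
rewrite invf_le1 ?powR_gt0 ?(lt_le_trans ltr01) //.
by rewrite -(powRr0 x) ler_powR // ltW.
Unshelve. all: by end_near. Qed.

End SubmultiplicativeExponent.

(** * Mass and Beurling dimensions from growth exponents *)

Section Dimensions.
Context {R : realType}.
Implicit Types (E : set R) (d : R).

Lemma uniformly_locally_finiteP E : uniformly_locally_finite E ->
  exists k, forall y, at_most (E `&` `[y - 1, y + 1]) k.
Proof.
move=> /(_ 1 ltr01) E1.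
have E0 : (0 <= max_count E 1)%E.
  apply: le_ereal_sup_tmp; exists (count_around E 0 1); first by exists 0.
  exact: counting_ge0.
have [c Ec] : exists c : R, max_count E 1 = c%:E.
  by move: E0 E1; case: (max_count E 1) => [c| |] // _ _; exists c.
exists (Num.trunc c) => y.
have /counting_at_most[n En nc] : (count_around E y 1 <= c%:E)%E.
  by rewrite -Ec; apply: ereal_sup_ubound; exists y.
by apply: at_mostW En => //; rewrite truncn_ge_nat // (le_trans _ nc).
Qed.

Lemma has_mass_dim_exponent E d : 0 <= d ->
  exponent_ge (count_around E 0) d -> exponent_le (count_around E 0) d ->
  has_mass_dim E d%:E.
Proof.
move=> d0 Ege Ele; split; apply/eqP; rewrite eq_le; apply/andP; split.
- apply/lee_addgt0Pr => e e0; apply: ereal_inf_lbound; exists (d + e) => //.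
  by split; [rewrite addr_ge0 // ltW|apply: limf_esup_powR_lty Ele _; rewrite ltrDl].
- apply: le_ereal_inf_tmp => _ [a [a0 Ea] <-]; rewrite lee_fin leNgt.
  apply/negP => /(limf_esup_powR _ _ _ Ege) Eoo.
  by move: Ea; rewrite /upper_mass_density Eoo ltxx.
- apply/lee_addgt0Pr => e e0; apply: ereal_inf_lbound; exists (d + e) => //.
  by split; [rewrite addr_ge0 // ltW|apply: limf_einf_powR_lty Ele _; rewrite ltrDl].
- apply: le_ereal_inf_tmp => _ [a [a0 Ea] <-]; rewrite lee_fin leNgt.
  apply/negP => /(limf_einf_powR _ _ _ Ege) Eoo.
  by move: Ea; rewrite /lower_mass_density Eoo ltxx.
Qed.

Lemma beurling_dim_exponent E d : 0 <= d ->
  exponent_ge (max_count E) d -> exponent_le (max_count E) d ->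
  beurling_dim E = d%:E.
Proof.
move=> d0 Ege Ele; apply/eqP; rewrite eq_le; apply/andP; split.
- apply/lee_addgt0Pr => e e0; apply: ereal_inf_lbound; exists (d + e) => //.
  by split; [rewrite ltr_wpDl|apply: limf_esup_powR_lty Ele _; rewrite ltrDl].
- apply: le_ereal_inf_tmp => _ [a [a0 Ea] <-]; rewrite lee_fin leNgt.
  apply/negP => /(limf_esup_powR _ _ _ Ege) Eoo.
  by move: Ea; rewrite /beurling_density Eoo ltxx.
Qed.

Lemma has_mass_dim_infty E : ~ locally_finite E -> has_mass_dim E +oo%E.
Proof.
move=> /existsNP[B /not_implyP[[M [_ BM]] infEB]].
have Eoo : \forall h \near +oo, count_around E 0 h = +oo%E.
  near=> h; apply: counting_infty => finE; apply: infEB.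
  apply: sub_finite_set finE => x [Ex Bx]; split=> //=.
  rewrite in_itv /= sub0r add0r -ler_norml.
  apply: (BM h) => //.
  by near: h; apply: nbhs_pinfty_gt; exact: num_real.
split.
- rewrite /upper_mass_dim (_ : [set _ | _] = set0) ?image_set0 ?ereal_inf0 //.
  apply/seteqP; split=> // a [_]; rewrite /upper_mass_density.
  by rewrite (limf_esup_powR _ (a + 1)) ?ltxx ?ltrDl //; exact: exponent_ge_infty.
- rewrite /lower_mass_dim (_ : [set _ | _] = set0) ?image_set0 ?ereal_inf0 //.
  apply/seteqP; split=> // a [_]; rewrite /lower_mass_density.
  by rewrite (limf_einf_powR _ (a + 1)) ?ltxx ?ltrDl //; exact: exponent_ge_infty.
Unshelve. all: by end_near. Qed.

Lemma beurling_dim_infty E : ~ uniformly_locally_finite E -> beurling_dim E = +oo%E.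
Proof.
move=> /existsNP[h0 /not_implyP[h0_gt0 /negP]].
rewrite -leNgt leye_eq => /eqP Eh0.
have Eoo : \forall h \near +oo, max_count E h = +oo%E.
  near=> h; have h0h : h0 <= h by near: h; exact: near_ge.
  apply/eqP; rewrite -leye_eq -Eh0; apply: ge_ereal_sup => _ [x _ <-].
  apply: le_ereal_sup_tmp; exists (count_around E x h); first by exists x.
  apply: le_counting => y [Ey]; rewrite /= !in_itv /= => /andP[xy yx]; split=> //.
  by rewrite (le_trans _ xy) ?lerB // (le_trans yx) // lerD.
rewrite /beurling_dim (_ : [set _ | _] = set0) ?image_set0 ?ereal_inf0 //.
apply/seteqP; split=> // a [_]; rewrite /beurling_density.
by rewrite (limf_esup_powR _ (a + 1)) ?ltxx ?ltrDl //; exact: exponent_ge_infty.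
Unshelve. all: by end_near. Qed.

(** An interval of radius h is covered by unit balls centred at the points c j,
which are spaced by 2. *)
Lemma at_most_around E (x h : R) (k : nat) : 0 <= h ->
  (forall y, at_most (E `&` `[y - 1, y + 1]) k) ->
  at_most (E `&` `[x - h, x + h]) ((Num.trunc h).+1 * k)%N.
Proof.
move=> h0 Ek; pose c (j : nat) := x - h + 2 * j%:R + 1.
apply: (@at_mostW _ _ (\bigcup_(j in `I_(Num.trunc h).+1)
   (E `&` `[c j - 1, c j + 1])) _ _ _ (leqnn _)).
  move=> y [Ey]; rewrite /= in_itv /= => /andP[xy yx].
  have y0 : 0 <= (y - (x - h)) / 2 by rewrite divr_ge0 // subr_ge0.
  exists (Num.trunc ((y - (x - h)) / 2)).
    by rewrite /= ltnS le_truncn // ler_pdivrMr //; lra.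
  split=> //; have /andP[] := truncn_itv y0.
  rewrite -natr1 /= in_itv /= /c; set t := (Num.trunc _)%:R.
  by rewrite ler_pdivlMr // ltr_pdivrMr // => ? ?; apply/andP; split; lra.
by apply: at_most_bigcup => //; exact: at_most_II.
Qed.

Lemma max_count_exponent_le1 E : uniformly_locally_finite E ->
  exponent_le (max_count E) 1.
Proof.
move=> ulf.
have [k Ek] : exists k, forall y, at_most (E `&` `[y - 1, y + 1]) k.
  exact: uniformly_locally_finiteP.
apply: (@exponent_le_scale _ _ id _ (2 * k%:R) 1) => //.
  move=> e e0; near=> x; rewrite lee_fin.
  by apply: le1r_powR; [near: x; exact: near_ge|rewrite lerDl ltW].
near=> h; have h1 : 1 <= h by near: h; exact: near_ge.
have h0 : 0 <= h by rewrite (le_trans ler01).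
apply: ge_ereal_sup => _ [x _ <-].
apply: (le_trans (at_most_counting _ _ _ _ (at_most_around _ _ _ _ h0 Ek))).
rewrite lee_fin natrM mul1r mulrAC ler_wpM2r // -natr1.
by rewrite (@le_trans _ _ (h + 1)) ?lerD2r ?truncn_le //; lra.
Unshelve. all: by end_near. Qed.

End Dimensions.

(** * Growth of the semigroup and of its orbits *)

Section Growth.
Context {R : realType} {m : nat} (r b : 'I_m -> R).
Context (mu rho : R) (mu_gt1 : 1 < mu) (rho_ge1 : 1 <= rho)
  (r_ge : forall i, mu <= `|r i|) (r_le : forall i, `|r i| <= rho).

Local Notation wmap := (word_map (affine_system r b)).
Local Notation orbit := (forward_orbit (affine_system r b)).

(** The function N of the introduction. *)
Definition num_maps (x : R) : nat := #|` fset_set (maps_upto r b x)|.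

(** The real growth function of the semigroup, without the identity. *)
Definition num_growth (x : R) : nat := #|` fset_set (growth_set r b x)|.

Lemma at_most_num_maps (x : R) : at_most (maps_upto r b x) (num_maps x).
Proof.
have [n /at_most_finite finx] := finite_maps_upto r b mu mu_gt1 r_ge x.
exact/at_mostE.
Qed.

Lemma num_maps_le (x : R) (n : nat) :
  at_most (maps_upto r b x) n -> (num_maps x <= n)%N.
Proof. by move=> /at_mostE[]. Qed.

Lemma at_most_num_growth (x : R) : at_most (growth_set r b x) (num_growth x).
Proof.
apply/at_mostE; split=> //; apply: at_most_finite.
by apply: at_mostW (leqnn _) (at_most_num_maps x); exact: growth_set_sub.
Qed.

Lemma num_growth_le (x : R) (n : nat) :
  at_most (growth_set r b x) n -> (num_growth x <= n)%N.
Proof. by move=> /at_mostE[]. Qed.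

Lemma growth_countE (x : R) :
  growth_count (affine_system r b) x = (num_growth x)%:R%:E.
Proof.
have /at_most_finite finx := at_most_num_growth x.
by rewrite /growth_count /counting asboolT.
Qed.

Lemma num_maps_gt0 (x : R) : 1 <= x -> (0 < num_maps x)%N.
Proof.
move=> x1; have [s sn As] := at_most_num_maps x.
have : wmap [::] \in s by apply: As; exists [::]; rewrite //= slope_nil normr1.
by case: s sn {As} => // g s /(leq_ltn_trans _) -> .
Qed.

Lemma num_growth_gt0 (x : R) : (0 < m)%N -> rho <= x -> (0 < num_growth x)%N.
Proof.
move=> hm x1; have [s sn As] := at_most_num_growth x.
have : wmap [:: Ordinal hm] \in s.
  apply: As; apply: growth_setP => //.
  by rewrite slope_cons slope_nil mulr1 (le_trans (r_le _)).
by case: s sn {As} => // g s /(leq_ltn_trans _) -> .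
Qed.

(** The lower bound is stated for the smaller of the two counting functions and
the upper bound for the larger one; they differ by at most 1. *)
Lemma growth_exponent : (0 < m)%N -> exists2 d : R, 0 <= d &
  exponent_ge (fun x => (num_growth x)%:R%:E) d /\
  exponent_le (fun x => (num_maps x)%:R%:E) d.
Proof.
move=> hm; have [x y xy|x|x y x1 y1|d d0 [dge dle]] :=
    submultiplicative_exponent num_maps rho rho_ge1.
- apply: num_maps_le; apply: at_mostW (leqnn _) (at_most_num_maps y).
  by move=> _ [w /= wx <-]; exists w => //=; exact: le_trans wx xy.
- exact: num_maps_gt0.
- apply: num_maps_le; apply: (at_most_mapsM r b rho) => //; exact: at_most_num_maps.
exists d => //; split=> //.
apply: (@exponent_ge_scale _ _ (fun x => (num_maps x)%:R) (fun=> 2) _ 1) => //.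
  by move=> e e0; exact: near_powR_ge.
near=> x; move=> c; rewrite lee_fin mul1r.
have x1 : rho <= x by near: x; exact: near_ge.
move=> /(ler_wpM2l (ler0n R 2)); apply: le_trans.
have Nx := at_most_maps_upto _ _ _ _ (at_most_num_growth x).
rewrite -natrM ler_nat (leq_trans (num_maps_le _ _ Nx)) //.
by have := num_growth_gt0 x hm x1; lia.
Unshelve. all: by end_near. Qed.

Lemma similarity_dim_ge0 (s : R) : (0 < m)%N -> is_similarity_dim r s -> 0 <= s.
Proof.
move=> hm hs; rewrite leNgt; apply/negP => s0; move: hs; apply/eqP; rewrite gt_eqF //.
rewrite (bigD1 (Ordinal hm)) //=.
have r1 : 1 < `|r (Ordinal hm)| by exact: lt_le_trans (r_ge _).
apply: (@lt_le_trans _ _ (`|r (Ordinal hm)| `^ (- s))).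
  by rewrite /powR gt_eqF ?(lt_trans ltr01) // expR_gt1 mulr_gt0 ?oppr_gt0 // ln_gt0.
by rewrite lerDl sumr_ge0 // => i _; exact: powR_ge0.
Qed.

Lemma le_similarity_dim (d s : R) : (0 < m)%N ->
  exponent_ge (fun x => (num_growth x)%:R%:E) d ->
  is_similarity_dim r s -> d <= s.
Proof.
move=> hm dge hs; have s0 := similarity_dim_ge0 s hm hs.
apply: (exponent_le_trans _ _ _ dge) => e e0.
have Lx := near_ln_powR mu e 1 mu_gt1 e0.
near=> x; have x0 : 0 < x by near: x; exact: near_gt0.
have Lx' : (max_length mu x).+1%:R <= x `^ e.
  by rewrite -[(max_length mu x).+1]expn1; near: x.
have xs : 0 <= x `^ s by exact: powR_ge0.
have Gx : at_most (growth_set r b x) ((max_length mu x).+1 * Num.trunc (x `^ s)).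
  apply: at_mostW (leqnn _) _; first exact: growth_set_sub.
  apply: (at_most_growth r b mu) => // n.
  by rewrite truncn_ge_nat //; apply: (count_words_le r mu).
rewrite lee_fin (@le_trans _ _ ((max_length mu x).+1 * Num.trunc (x `^ s))%:R) //.
  by rewrite ler_nat num_growth_le.
rewrite natrM powRD ?(gt_eqF x0) ?implybT // mulrC ler_pM //.
by rewrite truncn_le.
Unshelve. all: by end_near. Qed.

Context (beta : R) (beta_ge0 : 0 <= beta) (b_le : forall i, `|b i| <= beta).

(** No local finiteness is needed for the lower bound. *)
Lemma orbit_exponent_ge (a d : R) : (0 < m)%N ->
  exponent_ge (fun x => (num_growth x)%:R%:E) d ->
  exponent_ge (count_around (orbit a) 0) d.
Proof.
move=> hm dge; pose A := beta / (mu - 1); pose C := `|a| + A + 1.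
have A0 : 0 <= A by rewrite divr_ge0 // subr_ge0 ltW.
have C1 : 1 <= C by rewrite lerDr addr_ge0.
have C0 : 0 < C by exact: lt_le_trans C1.
apply: (@exponent_ge_scale _ _ (fun x => (num_growth x)%:R)
  (fun h => ((max_length mu h).+1 ^ m)%:R) _ C^-1) => //.
- by rewrite invr_gt0.
- by move=> e e0; exact: near_ln_powR.
near=> h; move=> c /counting_at_most[n On nc].
have h0 : 0 < h by near: h; exact: near_gt0.
have Gh : at_most (growth_set r b (C^-1 * h)) ((max_length mu (C^-1 * h)).+1 ^ m * n).
  apply: (at_most_orbit_lower r b mu mu_gt1 r_ge beta beta_ge0 b_le a).
  apply: at_mostW (leqnn _) On => y [Oy]; rewrite /= !in_itv /= => /andP[y1 y2].
  have Ch : (`|a| + A) * (C^-1 * h) <= h.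
    by rewrite mulrA ler_piMl ?(ltW h0) // ler_pdivrMr // mul1r lerDl.
  split=> //; rewrite (le_trans _ y1) ?(le_trans y2) //.
  - by rewrite lerD2l.
  - by rewrite lerB.
apply: (@le_trans _ _ (((max_length mu (C^-1 * h)).+1 ^ m * n)%:R)).
  by rewrite ler_nat num_growth_le.
rewrite natrM ler_pM // ler_nat leq_exp2r // ltnS le_truncn //.
rewrite ler_wpM2r ?invr_ge0 ?ln_ge0 ?(ltW mu_gt1) //.
rewrite ler_ln ?posrE ?mulr_gt0 ?invr_gt0 //.
by rewrite ler_piMl ?(ltW h0) // invf_le1.
Unshelve. all: by end_near. Qed.

Lemma orbit_exponent_le (a d : R) : exponent_le (fun x => (num_maps x)%:R%:E) d ->
  locally_finite (orbit a) -> exponent_le (count_around (orbit a) 0) d.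
Proof.
move=> dle lf; pose A := beta / (mu - 1).
have [n On] : exists n, at_most (orbit a `&` `[- (A + 1), A + 1]) n.
  have finO : finite_set (orbit a `&` `[- (A + 1), A + 1]).
    by apply: lf; apply: compact_bounded; exact: segment_compact.
  by exists #|` fset_set (orbit a `&` `[- (A + 1), A + 1])|; apply/at_mostE.
apply: (@exponent_le_scale _ _ (fun x => (num_maps x)%:R) _ n.+1%:R rho) => //.
  exact: lt_le_trans rho_ge1.
near=> h; have h1 : 1 <= h by near: h; exact: near_ge.
rewrite mulrC -natrM; apply: at_most_counting.
apply: (at_most_orbit_upper r b mu rho) => //; first exact: at_most_num_maps.
move=> u; apply: at_mostW (leqnn _) On => y [Oy]; rewrite /= !in_itv /= => yu.
have s0 : 0 < `|slope r u| by rewrite normr_gt0 (slope_neq0 r mu).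
have : `|(0 - wmap u 0) / slope r u| <= A.
  rewrite sub0r mulNr normrN normrM normfV ler_pdivrMr //.
  exact: (word_map0_le r b mu).
rewrite ler_norml => /andP[? ?]; split=> //; move: yu => /andP[? ?].
by apply/andP; split; lra.
Unshelve. all: by end_near. Qed.

Lemma max_count_orbit_exponent_le (a d : R) :
  exponent_le (fun x => (num_maps x)%:R%:E) d ->
  uniformly_locally_finite (orbit a) -> exponent_le (max_count (orbit a)) d.
Proof.
move=> dle /uniformly_locally_finiteP[n On].
apply: (@exponent_le_scale _ _ (fun x => (num_maps x)%:R) _ n.+1%:R rho) => //.
  exact: lt_le_trans rho_ge1.
near=> h; have h1 : 1 <= h by near: h; exact: near_ge.
apply: ge_ereal_sup => _ [x _ <-].
rewrite mulrC -natrM; apply: at_most_counting.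
by apply: (at_most_orbit_upper r b mu rho) => //; exact: at_most_num_maps.
Unshelve. all: by end_near. Qed.

End Growth.

(** * Packing and covering numbers *)

Section Packing.
Context {R : realType} (K : set R).

(** K contains n points with mutual distances larger than e. *)
Definition is_packing (e : R) (n : nat) : Prop :=
  exists x : 'I_n -> R,
    (forall i, K (x i)) /\ (forall i j, i != j -> e < `|x i - x j|).

Lemma is_packing_fintype (I : finType) (x : I -> R) (e : R) :
  (forall i, K (x i)) -> (forall i j, i != j -> e < `|x i - x j|) ->
  is_packing e #|I|.
Proof.
move=> Kx xe; exists (fun i => x (enum_val i)); split=> // i j ij; apply: xe.
by apply: contra ij => /eqP/enum_val_inj ->.
Qed.

Context (A : R) (K_le : forall x, K x -> `|x| <= A) (K0 : K !=set0).

Lemma packing_le (e : R) (n : nat) : 0 < e -> is_packing e n ->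
  (n <= (Num.trunc (2 * A / e)).+1)%N.
Proof.
move=> e0 [x [Kx xe]].
have xA i : 0 <= (x i + A) / e <= 2 * A / e.
  have := K_le _ (Kx i); rewrite ler_norml => /andP[? ?].
  by rewrite divr_ge0 ?ler_pM2r ?invr_gt0 ?(ltW e0) //=; lra.
pose k i : 'I_(Num.trunc (2 * A / e)).+1 := inord (Num.trunc ((x i + A) / e)).
have kE i : (k i : nat) = Num.trunc ((x i + A) / e).
  by rewrite inordK // ltnS le_truncn //; case/andP: (xA i).
suff /leq_card : injective k by rewrite !card_ord.
move=> i j kij; apply/eqP; apply: contraT => /xe.
have := kE i; rewrite kij kE => tij.
have /andP[i0 _] := xA i; have /andP[j0 _] := xA j.
have := truncn_itv i0; have := truncn_itv j0; rewrite -tij -natr1.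
set t := (Num.trunc _)%:R; rewrite !ler_pdivlMr // !ltr_pdivrMr //.
move=> /andP[? ?] /andP[? ?]; rewrite ltNge ler_distl => /negP; case.
by apply/andP; split; lra.
Qed.

(** The largest size of a packing, meaningful for e > 0 and K bounded; see
[packing_numberP]. *)
Definition packing_number (e : R) : nat :=
  xget 0%N [set n | is_packing e n /\ forall k, is_packing e k -> (k <= n)%N].

Lemma packing_numberP (e : R) : 0 < e ->
  is_packing e (packing_number e) /\
  forall k, is_packing e k -> (k <= packing_number e)%N.
Proof.
move=> e0; rewrite /packing_number; case: xgetP => [n _ //|/= noN].
have ex : exists n, `[< is_packing e n >].
  by exists 0%N; apply/asboolP; exists (fun=> 0); split; case.
have ub n : `[< is_packing e n >] -> (n <= (Num.trunc (2 * A / e)).+1)%N.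
  by move=> /asboolP; exact: packing_le.
case: (ex_maxnP ex ub) => n /asboolP en nmax.
by case: (noN n); split=> // k ek; apply: nmax; apply/asboolP.
Qed.

Lemma packing_number_gt0 (e : R) : 0 < e -> (0 < packing_number e)%N.
Proof.
move=> e0; apply: (packing_numberP _ e0).2; case: K0 => x Kx.
by exists (fun=> x); split=> // i j; rewrite (ord1 i) (ord1 j) eqxx.
Qed.

Lemma packing_le_covering (e : R) : 0 < e ->
  ((packing_number e)%:R%:E <= covering_number K e)%E.
Proof.
move=> e0; apply: le_ereal_inf_tmp => _ [n [U [Ue KU]] <-].
rewrite lee_fin ler_nat.
have [[x [Kx xe]] _] := packing_numberP _ e0.
have /choice[k kP] : forall i, exists k, U k (x i).
  by move=> i; have [k _ Uk] := KU _ (Kx i); exists k.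
suff /leq_card : injective k by rewrite !card_ord.
move=> i j kij; apply/eqP; apply: contraT => /xe.
by rewrite ltNge (Ue (k i)) // kij.
Qed.

(** The closed balls of radius e around a packing of maximal size cover K. *)
Lemma covering_le_packing (e : R) : 0 < e ->
  (covering_number K (2 * e) <= (packing_number e)%:R%:E)%E.
Proof.
move=> e0; apply: ereal_inf_lbound; exists (packing_number e) => //.
have [[x [Kx xe]] xmax] := packing_numberP _ e0.
exists (fun i => [set y | `|y - x i| <= e]); split.
  move=> i y z /= yx zx; rewrite (le_trans (ler_distD (x i) _ _)) //.
  by rewrite [X in _ + X]distrC; lra.
move=> y Ky; apply: contrapT => noi.
have yx i : e < `|y - x i|.
  by rewrite ltNge; apply/negP => yi; apply: noi; exists i.
suff : is_packing e (packing_number e).+1 by move=> /xmax; rewrite ltnn.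
rewrite -[X in is_packing _ X.+1]card_ord -card_option.
apply: (@is_packing_fintype _ (fun o => if o is Some i then x i else y)).
  by case.
move=> [i|] [j|] //= ij; first by apply: xe; apply: contra ij => /eqP ->.
by rewrite distrC.
Qed.

End Packing.

(** * The attractor of the dual system *)

Section Attractor.
Context {R : realType} {m : nat} (r b : 'I_m -> R).
Context (mu rho : R) (mu_gt1 : 1 < mu) (rho_ge1 : 1 <= rho)
  (r_ge : forall i, mu <= `|r i|) (r_le : forall i, `|r i| <= rho).
Context (K : set R) (attrK : is_attractor (dual_system r b) K).

Local Notation wmap := (word_map (affine_system r b)).

(** The inverse branches map K into itself. *)
Lemma attractor_preimage (w : seq 'I_m) (z : R) : K (wmap w z) -> K z.
Proof.
elim: w => //= i w IH; rewrite /affine_system => Kz; apply: IH.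
case: attrK => _ _ ->; exists i => //; exists (r i * wmap w z + b i) => //.
have ri := r_neq0 r mu mu_gt1 r_ge i.
by rewrite /dual_system; field.
Qed.

(** Reading the address of x in K until the slope reaches H: x lies in the copy
f_w^-1(K) of K, whose size is comparable to 1 / H. *)
Lemma attractor_expand (H x : R) : 1 <= H -> K x ->
  exists w, [/\ K (wmap w x), H <= `|slope r w| & `|slope r w| <= rho * H].
Proof.
move=> H1 Kx.
have rho0 : 0 < rho by exact: lt_le_trans rho_ge1.
have /(_ (max_length mu H).+1)[w [Kw wH [|sw]]] : forall n, exists w,
    [/\ K (wmap w x), `|slope r w| <= rho * H & H <= `|slope r w| \/ size w = n].
- elim=> [|n [w [Kw wH [Hw|sw]]]].
  + by exists [::]; split; [|rewrite slope_nil normr1 mulr_ege1|right].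
  + by exists w; split=> //; left.
  + have [Hw|wH'] := leP H `|slope r w|; first by exists w; split=> //; left.
    have [_ _ KE] := attrK; move: Kw; rewrite {1}KE => -[i _ [y Ky yw]].
    have ri := r_neq0 r mu mu_gt1 r_ge i.
    exists (i :: w); split; [| |by right; rewrite /= sw]; last first.
      by rewrite slope_cons normrM ler_pM // ltW.
    suff -> : wmap (i :: w) x = y by [].
    by rewrite /= -yw /affine_system /dual_system; field.
- by move=> Hw; exists w.
- exists w; split=> //; rewrite leNgt; apply/negP => /ltW.
  by move/(size_le_max_length r mu mu_gt1 r_ge); rewrite sw ltnn.
Qed.

Context (A : R) (K_le : forall x, K x -> `|x| <= A).

(* Four times the bound 2 * A on the distances in K, made at least 2: a copy of
   K of slope at least C / e has diameter at most e / 4. *)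
Let C : R := 8 * A + 2.
Let kappa : R := rho * C.

Let A_ge0 : 0 <= A.
Proof. by case: attrK => _ [x /K_le xA] _; exact: le_trans xA. Qed.

Let C_ge2 : 2 <= C.
Proof. by have := A_ge0; rewrite /C; lra. Qed.

Let kappa_ge2 : 2 <= kappa.
Proof. by rewrite /kappa -[2]mul1r ler_pM. Qed.

Let K_dist (x y : R) : K x -> K y -> `|x - y| <= 2 * A.
Proof.
move=> /K_le xA /K_le yA; apply: (le_trans (ler_normB _ _)).
have -> : 2 * A = A + A by ring.
by rewrite lerD.
Qed.

Let K0 : K !=set0. Proof. by case: attrK. Qed.

Lemma packing_supermultiplicative (e e' : R) : 0 < e <= 1 -> 0 < e' <= 1 ->
  (packing_number K e * packing_number K e' <=
   packing_number K (e * e' / kappa)%R)%N.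
Proof.
move=> /andP[e0 e1] /andP[e'0 e'1].
have k0 : 0 < kappa by exact: lt_le_trans kappa_ge2.
have C0 : 0 < C by exact: lt_le_trans C_ge2.
have ee0 : 0 < e * e' / kappa by rewrite divr_gt0 // mulr_gt0.
apply: (packing_numberP K A K_le _ ee0).2.
have [[x [Kx xe]] _] := packing_numberP K A K_le _ e0.
have [[y [Ky ye]] _] := packing_numberP K A K_le _ e'0.
have H1 : 1 <= C / e.
  by rewrite ler_pdivlMr // mul1r (le_trans e1) // (le_trans _ C_ge2) // ler1n.
have /choice[w wP] := fun i => attractor_expand (C / e) (x i) H1 (Kx i).
have s0 i : slope r (w i) != 0 by exact: (slope_neq0 r mu).
have sn0 i : 0 < `|slope r (w i)| by rewrite normr_gt0.
(* z (i, j) is the copy of y j in the piece of K near x i. *)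
pose z (ij : 'I_(packing_number K e) * 'I_(packing_number K e')) :=
  (y ij.2 - wmap (w ij.1) 0) / slope r (w ij.1).
have zP ij : wmap (w ij.1) (z ij) = y ij.2.
  by rewrite word_mapE /z; field.
rewrite -[X in is_packing _ _ (X * _)]card_ord.
rewrite -[X in is_packing _ _ (_ * X)]card_ord -card_prod.
apply: (@is_packing_fintype _ _ _ z).
  by move=> ij; apply: (attractor_preimage (w ij.1)); rewrite zP.
have zx ij : `|z ij - x ij.1| <= e / 4.
  have [Kw wH _] := wP ij.1.
  have : `|slope r (w ij.1)| * `|z ij - x ij.1| <= 2 * A.
    by rewrite -normrM -(word_mapB r b) zP; apply: K_dist.
  move: wH; rewrite ler_pdivrMr // => wH.
  set s := `|slope _ _| in wH *; set t := `|_ - _|.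
  move=> st; rewrite leNgt; apply/negP => et.
  have : s * (e / 4) < s * t by rewrite ltr_pM2l // /s.
  by rewrite /C in wH; lra.
move=> [i j] [i' j'] /=; rewrite xpair_eqE negb_and.
(* Two points in the same copy of K are separated because y is, two points in
   different copies because each is within e / 4 of its x i. *)
have [<-{i'} /= jj'|ii' _] := eqVneq i i'.
  have [_ _ wH] := wP i.
  have := ye _ _ jj'; rewrite -(zP (i, j)) -(zP (i, j')) /= word_mapB normrM.
  set t := `|_ - _| => st.
  rewrite ltr_pdivrMr //; rewrite mulrA ler_pdivlMr // in wH.
  have t0 : 0 <= t by exact: normr_ge0.
  rewrite (lt_le_trans (_ : _ < e * (`|slope r (w i)| * t))) ?ltr_pM2l //.
  by rewrite mulrA mulrC ler_wpM2l // mulrC.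
have xx := xe _ _ ii'; have z1 := zx (i, j); have z2 := zx (i', j').
have ek : e * e' / kappa <= e / 2.
  rewrite ler_pdivrMr // -mulrA ler_wpM2l ?(ltW e0) //.
  by rewrite (le_trans e'1) // mulrC ler_pdivlMr // mul1r.
rewrite (le_lt_trans ek) //.
have : `|x i - x i'| <=
    `|z (i, j) - x i| + `|z (i, j) - z (i', j')| + `|z (i', j') - x i'|.
  rewrite (le_trans (ler_distD (z (i, j)) _ _)) // distrC -addrA lerD2l.
  exact: ler_distD.
by rewrite /= in z1 z2 *; lra.
Qed.

(** The linear bound that makes Fekete's lemma produce a finite exponent. *)
Lemma packing_number_upper (e : R) : 0 < e <= 1 ->
  (packing_number K (kappa * e))%:R <= 2 / e.
Proof.
move=> /andP[e0 e1].
have k0 : 0 < kappa by exact: lt_le_trans kappa_ge2.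
have ke0 : 0 < kappa * e by exact: mulr_gt0.
have /(packing_le K A K_le _ _ ke0) :
    is_packing K (kappa * e) (packing_number K (kappa * e)).
  exact: (packing_numberP K A K_le _ ke0).1.
rewrite -(ler_nat R) => /le_trans; apply.
have AC : 2 * A <= C by have := A_ge0; rewrite /C; lra.
have CA : 2 * A <= kappa by rewrite (le_trans AC) // ler_peMl // (le_trans _ C_ge2).
have Ae : 2 * A / (kappa * e) <= e^-1.
  by rewrite ler_pdivrMr // mulrCA mulVf ?gt_eqF // mulr1.
rewrite -natr1 (@le_trans _ _ (e^-1 + 1)) //.
  rewrite lerD2r (le_trans _ Ae) // truncn_le divr_ge0 ?(ltW ke0) // mulr_ge0 //.
have : 1 <= e^-1 by rewrite invf_ge1.
by lra.
Qed.

Lemma packing_exponent : exists D : R,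
  exponent_ge (fun x => (packing_number K (kappa / x))%:R%:E) D /\
  exponent_le (fun x => (packing_number K (kappa / x))%:R%:E) D.
Proof.
have k0 : 0 < kappa by exact: lt_le_trans kappa_ge2.
have k1 : 1 < kappa by rewrite (lt_le_trans _ kappa_ge2) // ltr1n.
have P0 t : (0 < packing_number K (kappa * expR (- t)))%N.
  by apply: (packing_number_gt0 K A) => //; rewrite mulr_gt0 // expR_gt0.
have lnk := ln_gt0 k1.
have le1 t : ln kappa <= t -> 0 < kappa * expR (- t) <= 1.
  move=> kt; rewrite mulr_gt0 ?expR_gt0 //=.
  by rewrite expRN ler_pdivrMr ?expR_gt0 // mul1r -[leLHS]lnK ?posrE // ler_expR.
pose q t : R := ln (packing_number K (kappa * expR (- t)))%:R.
have [L qL] : exists L : R, - q t / t @[t --> +oo] --> L.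
  (* The rescaling by kappa absorbs the loss in the supermultiplicativity, which
     holds for scales at most 1, that is for t at least ln kappa. *)
  apply: (@fekete _ (fun t => - q t) (ln kappa) 2) => //.
  - move=> s t ks kt; rewrite -opprD lerN2 /q.
    rewrite -lnM ?posrE ?ltr0n // -natrM ler_ln ?posrE ?ltr0n ?muln_gt0 ?P0 //.
    have Pst := packing_supermultiplicative _ _ (le1 _ ks) (le1 _ kt).
    rewrite ler_nat (leq_trans Pst) //.
    apply: eq_leq; congr (packing_number K _).
    by rewrite opprD expRD; field; rewrite gt_eqF.
  - by move=> T; exists 0 => t _; rewrite oppr_le0 ln_ge0 // ler1n.
  - move=> t kt; rewrite lerN2 /q.
    have t0 : 0 <= t by exact: le_trans (ltW lnk) kt.
    have et : 0 < expR (- t) <= 1 by rewrite expR_gt0 -[leRHS]expR0 ler_expR oppr_le0.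
    rewrite -[leRHS]expRK ler_ln ?posrE ?expR_gt0 ?ltr0n //.
    rewrite (le_trans (packing_number_upper _ et)) // expRN invrK.
    have -> : 2 * t = t + t by ring.
    rewrite expRD ler_wpM2r ?expR_ge0 //.
    by rewrite (le_trans kappa_ge2) // -[leLHS]lnK ?posrE // ler_expR.
have qD : q t / t @[t --> +oo] --> - L.
  rewrite (_ : (fun t => q t / t) = (fun t => - (- q t / t))); first exact: cvgN.
  by apply/funext => t; rewrite mulNr opprK.
have [qge qle] := exponent_of_lim _ _ qD.
have qE x : 0 < x -> expR (q (ln x)) = (packing_number K (kappa / x))%:R.
  by move=> x0; rewrite /q lnK ?posrE ?ltr0n // expRN lnK ?posrE.
exists (- L); split.
- move=> e e0; near=> x; rewrite -qE; last by near: x; exact: near_gt0.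
  by near: x; exact: qge.
- move=> e e0; near=> x; rewrite -qE; last by near: x; exact: near_gt0.
  by near: x; exact: qle.
Unshelve. all: by end_near. Qed.

Lemma covering_exponent (D : R) :
  exponent_ge (fun x => (packing_number K (kappa / x))%:R%:E) D ->
  exponent_le (fun x => (packing_number K (kappa / x))%:R%:E) D ->
  exponent_ge (fun x => covering_number K x^-1) D /\
  exponent_le (fun x => covering_number K x^-1) D.
Proof.
have k0 : 0 < kappa by exact: lt_le_trans kappa_ge2.
move=> Dge Dle; split.
- apply: (@exponent_ge_scale _ _ (fun x => (packing_number K (kappa / x))%:R)
    (fun=> 1) _ kappa) => //.
    by move=> e e0; exact: near_powR_ge.
  near=> x; have x0 : 0 < x by near: x; exact: near_gt0.
  move=> c; rewrite mul1r -lee_fin; apply: le_trans.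
  have -> : kappa / (kappa * x) = x^-1 by field; rewrite !gt_eqF.
  by apply: (packing_le_covering K A) => //; rewrite invr_gt0.
- apply: (@exponent_le_scale _ _ (fun x => (packing_number K (kappa / x))%:R)
    _ 1 (2 * kappa)) => //.
    by rewrite mulr_gt0.
  near=> x; have x0 : 0 < x by near: x; exact: near_gt0.
  have -> : x^-1 = 2 * (kappa / (2 * kappa * x)) by field; rewrite !gt_eqF.
  rewrite mul1r; apply: (covering_le_packing K A) => //.
  by rewrite divr_gt0 // mulr_gt0 // mulr_gt0.
Unshelve. all: by end_near. Qed.

(** If two points of K were sent into K by the same map of slope at least x / rho,
their distance could not exceed kappa / x. *)
Lemma packing_le_num_maps (x : R) : rho <= x ->
  (packing_number K (kappa / x)%R <= num_maps r b x)%N.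
Proof.
move=> rx; have rho0 : 0 < rho by exact: lt_le_trans rho_ge1.
have x0 : 0 < x by exact: lt_le_trans rx.
have k0 : 0 < kappa by exact: lt_le_trans kappa_ge2.
have H1 : 1 <= x / rho by rewrite ler_pdivlMr // mul1r.
have kx0 : 0 < kappa / x by rewrite divr_gt0.
have [[y [Ky ye]] _] := packing_numberP K A K_le _ kx0.
have /choice[w wP] := fun i => attractor_expand (x / rho) (y i) H1 (Ky i).
have [s sn As] := at_most_num_maps r b mu mu_gt1 r_ge x.
rewrite -[X in (X <= _)%N]card_ord cardE -(size_map (fun i => wmap (w i))).
apply: leq_trans sn; apply: uniq_leq_size; last first.
  move=> _ /mapP[i _ ->]; apply: As; exists (w i) => //=.
  by have [_ _] := wP i; rewrite mulrCA mulfV ?mulr1 // gt_eqF.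
rewrite map_inj_uniq ?enum_uniq // => i j wij.
apply/eqP; apply: contraT => /ye.
have [Ki wi _] := wP i; have [Kj _ _] := wP j.
have := K_dist _ _ Ki Kj; rewrite -wij word_mapB normrM.
set s' := `|slope _ _| in wi *; set t := `|_ - _| => st kt.
have : x / rho * (kappa / x) <= s' * t by rewrite ler_pM // ?divr_ge0 // ltW.
have -> : x / rho * (kappa / x) = C.
  by rewrite /kappa; field; rewrite !gt_eqF.
by have := A_ge0; rewrite /C; lra.
Qed.

Lemma attractor_box_dim (d : R) : exponent_le (fun x => (num_maps r b x)%:R%:E) d ->
  exists D : R, has_box_dim K D%:E /\ D <= d.
Proof.
move=> dle; have [D [Dge Dle]] := packing_exponent.
have [cge cle] := covering_exponent _ Dge Dle.
exists D; split; last first.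
  apply: (exponent_le_trans _ _ _ Dge).
  apply: (@exponent_le_scale _ _ (fun x => (num_maps r b x)%:R) _ 1 1) => //.
  by near=> x; rewrite !mul1r lee_fin ler_nat packing_le_num_maps.
have lim := exponent_lim _ _ cge cle.
have inv0 : (e^-1 : R) @[e --> (0 : R)^'+] --> +oo.
  apply/cvgryPge => M; near=> e.
  have e0 : 0 < e by near: e; exact: nbhs_right_gt.
  rewrite (le_trans (ler_norm _)) // (@le_trans _ _ (`|M| + 1)) ?lerDl //.
  rewrite -[leLHS]invrK lef_pV2 ?posrE ?invr_gt0 ?ltr_wpDl //.
  by near: e; apply: nbhs_right_le; rewrite invr_gt0 ltr_wpDl.
rewrite /has_box_dim; have := cvg_comp _ _ inv0 lim; apply: cvg_trans.
apply: near_eq_cvg; near=> e.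
have e0 : 0 < e by near: e; exact: nbhs_right_gt.
by rewrite /= invrK lnV ?posrE.
Unshelve. all: by end_near. Qed.

End Attractor.

Theorem theorem1p1 (R : realType) (m : nat) (r b : 'I_m -> R)
    (hm : (0 < m)%N)
    (hr : forall i, 1 < `|r i|)
    (hdistinct : injective (affine_system r b)) :
  let F := affine_system r b in
  exists d : R,
  [/\ (lne (growth_count F x) / (ln x)%:E)%E @[x --> +oo] --> d%:E,
      (forall K : set R, is_attractor (dual_system r b) K ->
        exists D : R, has_box_dim K D%:E /\ D <= d),
      (forall s : R, is_similarity_dim r s -> d <= s),
      (forall a : R,
        (locally_finite (forward_orbit F a) -> has_mass_dim (forward_orbit F a) d%:E) /\
        (~ locally_finite (forward_orbit F a) -> has_mass_dim (forward_orbit F a) +oo%E)) &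
      (forall a : R,
        (uniformly_locally_finite (forward_orbit F a) ->
          beurling_dim (forward_orbit F a) = d%:E /\ d <= 1) /\
        (~ uniformly_locally_finite (forward_orbit F a) ->
          beurling_dim (forward_orbit F a) = +oo%E))].
Proof.
move=> F.
pose i0 := [arg min_(i < Ordinal hm) `|r i|]%O.
pose mu := `|r i0|.
have mu_gt1 : 1 < mu by exact: hr.
have r_ge i : mu <= `|r i|.
  by rewrite /mu /i0; case: arg_minP => // j _ jmin; exact: jmin.
pose rho := 1 + \sum_i `|r i|.
have rho_ge1 : 1 <= rho by rewrite lerDl sumr_ge0.
have r_le i : `|r i| <= rho.
  by rewrite /rho (bigD1 i) //= addrCA lerDl addr_ge0 // sumr_ge0.
pose beta := \sum_i `|b i|.
have beta_ge0 : 0 <= beta by rewrite sumr_ge0.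
have b_le i : `|b i| <= beta by rewrite /beta (bigD1 i) //= lerDl sumr_ge0.
have [d d0 [dge dle]] := growth_exponent r b mu rho mu_gt1 rho_ge1 r_ge r_le hm.
have countE x := growth_countE r b mu mu_gt1 r_ge x.
exists d; split.
- apply: exponent_lim => [e e0|e e0]; near=> x; rewrite countE.
    by near: x; exact: dge.
  apply: (@le_trans _ _ (num_maps r b x)%:R%:E); last by near: x; exact: dle.
  rewrite lee_fin ler_nat; apply: num_growth_le.
  apply: at_mostW (leqnn _) (at_most_num_maps r b mu mu_gt1 r_ge x).
  exact: growth_set_sub.
- move=> K attrK; have [/compact_bounded[M [_ KM]] _ _] := attrK.
  have K_le x : K x -> `|x| <= M + 1 by move=> Kx; apply: KM => //; rewrite ltrDl.
  exact: (attractor_box_dim r b mu rho mu_gt1 rho_ge1 r_ge r_le K attrK (M + 1) K_le).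
- by move=> s; exact: (le_similarity_dim r b mu mu_gt1 r_ge).
- move=> a; split; last exact: has_mass_dim_infty.
  move=> lf; apply: has_mass_dim_exponent => //.
    exact: (orbit_exponent_ge r b mu mu_gt1 r_ge beta beta_ge0 b_le).
  exact: (orbit_exponent_le r b mu rho mu_gt1 rho_ge1 r_ge r_le beta beta_ge0 b_le).
- move=> a; split; last exact: beurling_dim_infty.
  move=> ulf.
  have oge : exponent_ge (max_count (forward_orbit F a)) d.
    move=> e e0; near=> h.
    apply: (@le_trans _ _ (count_around (forward_orbit F a) 0 h)).
      near: h; move: e e0.
      exact: (orbit_exponent_ge r b mu mu_gt1 r_ge beta beta_ge0 b_le).
    by apply: ereal_sup_ubound; exists 0.
  split.
    apply: beurling_dim_exponent => //.
    exact: (max_count_orbit_exponent_le r b mu rho mu_gt1 rho_ge1 r_ge r_le).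
  exact: (exponent_le_trans _ _ _ oge (max_count_exponent_le1 _ ulf)).
Unshelve. all: by end_near. Qed.
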